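(* Let $g>1$, let $\mu$ be a probability measure on $\mathbb T$ with infinite support and Verblunsky coefficients $(\alpha_k)_{k\ge0}$, and let $\mathfrak a=-\sqrt{1-g^{-1}}$. Then $$\sup_{L\ge1}\sum_{k=0}^L\left(-g\,\mathrm{Re}\left(\alpha_k\bar\alpha_{k-1}-\alpha_k^g\bar\alpha_{k-1}^g\right)-\log\frac{1-|\alpha_k|^2}{1-|\alpha_k^g|^2}\right)<\infty$$ if and only if the following two conditions are satisfied: $$\sum_{k=0}^\infty|\alpha_{k+1}-\alpha_k|^2<\infty,\qquad\sum_{k=0}^\infty\left(|\alpha_k|-|\mathfrak a|\right)^2<\infty .$$
   Context: $\mathbb T$ is the unit circle. For a probability measure $\mu$ on $\mathbb T$ with infinite support, let $\Phi_k$ be the monic orthogonal polynomials in $L^2(\mu)$; its Verblunsky coefficients are $\alpha_k=-\overline{\Phi_{k+1}(0)}$, $k\ge0$, and by convention the coefficient with index $-1$ equals $-1$ for every measure. For $g>1$, $(\alpha_k^g)_{k\ge0}$ are the Verblunsky coefficients of the Gross-Witten measure $\mathrm{GW}_g$, the probability measure on $\mathbb T$ with density, with respect to $d\theta$, $$\frac g\pi\sin(\theta/2)\sqrt{\sin^2(\theta/2)-\cos^2(\theta_g/2)}\;\mathbf 1_{[\pi-\theta_g,\pi+\theta_g]}(\theta),$$ where $\theta_g\in(0,\pi)$ satisfies $\sin^2(\theta_g/2)=g^{-1}$. Explicitly (a known formula), with $q=(\sqrt g-\sqrt{g-1})^2$, $\alpha_{n-1}^g=1-\frac{2}{1+q}\,\frac{1-q^{n+2}}{1-q^{n+1}}$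 for $n\ge0$, so that $\alpha_n^g\to\mathfrak a$. *)

(* Defs.v *)
From HB Require Import structures.
From mathcomp Require Import all_boot all_order all_algebra.
From mathcomp Require Export complex.
From mathcomp Require Import all_classical all_reals all_analysis measurable_realfun.
Set Implicit Arguments.
Unset Strict Implicit.
Unset Printing Implicit Defensive.
Import Order.TTheory GRing.Theory Num.Theory.
Import ComplexField.Normc.
Import numFieldTopology.Exports numFieldNormedType.Exports.
Local Open Scope classical_set_scope.
Local Open Scope ring_scope.
Local Open Scope complex_scope.

(* The complex plane is R * R as a measurable (Borel) and topological space,
   and R[i] as a field; [toC] passes from the former to the latter.  A measure
   on the unit circle is a measure on R * R carried by [unit_circle]. *)

Definition toC (R : realType) (z : R * R) : R[i] := z.1 +i* z.2.

Definition unit_circle (R : realType) : set (R * R) :=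
  [set z | normc (toC z) = 1].

Definition expi (R : realType) (t : R) : R * R := (cos t, sin t).

Definition msupport (R : realType) (mu : {measure set (R * R) -> \bar R}) :
    set (R * R) :=
  [set z | forall U : set (R * R), open U -> U z -> (0 < mu U)%E].

Definition cintegral (R : realType) (mu : {measure set (R * R) -> \bar R})
    (f : R * R -> R[i]) : R[i] :=
  Rintegral mu setT (fun z => complex.Re (f z)) +i*
  Rintegral mu setT (fun z => complex.Im (f z)).

Definition inner (R : realType) (mu : {measure set (R * R) -> \bar R})
    (p q : {poly R[i]}) : R[i] :=
  cintegral mu (fun z => (p.[toC z])^*%C * q.[toC z]).

Definition monic_orthogonal (R : realType)
    (mu : {measure set (R * R) -> \bar R}) (Phi : nat -> {poly R[i]}) : Prop :=
  [/\ forall k, Phi k \is monic,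
      forall k, size (Phi k) = k.+1 &
      forall j k, j != k -> inner mu (Phi j) (Phi k) = 0].

Definition verblunsky (R : realType) (mu : {measure set (R * R) -> \bar R})
    (alpha : nat -> R[i]) : Prop :=
  exists2 Phi, monic_orthogonal mu Phi &
    forall k, alpha k = - ((Phi k.+1).[0])^*%C.

(* [prev alpha k] is the coefficient with index k - 1. *)
Definition prev (R : realType) (alpha : nat -> R[i]) (k : nat) : R[i] :=
  if k is j.+1 then alpha j else -1.

Definition theta_g (R : realType) (g : R) : R := 2 * asin (Num.sqrt g^-1).

Lemma theta_gP (R : realType) (g : R) : 1 < g ->
  0 < theta_g g < pi /\ sin (theta_g g / 2) ^+ 2 = g^-1.
Proof.
move=> g1; have g0 : 0 < g by exact: lt_trans g1.
have s0 : 0 < Num.sqrt g^-1 by rewrite sqrtr_gt0 invr_gt0.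
have s1 : Num.sqrt g^-1 < 1.
  by rewrite -sqrtr1 ltr_sqrt// invf_lt1.
have sI : -1 <= Num.sqrt g^-1 <= 1.
  by rewrite (ltW s1) andbT (le_trans _ (ltW s0))// lerN10.
have sE : sin (asin (Num.sqrt g^-1)) = Num.sqrt g^-1.
  by rewrite asinK// in_itv.
rewrite /theta_g; split; last first.
  by rewrite mulrC mulKf ?pnatr_eq0// sE sqr_sqrtr// invr_ge0 ltW.
apply/andP; split; last first.
  rewrite mulrC -ltr_pdivlMr//; apply: asin_ltpi2.
  by rewrite s1 andbT (le_trans _ (ltW s0))// lerN10.
rewrite pmulr_rgt0// ltNge; apply/negP => a0.
suff : sin (asin (Num.sqrt g^-1)) <= 0 by rewrite sE leNgt s0.
rewrite -oppr_ge0 -sinN; apply: sin_ge0_pi.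
rewrite oppr_ge0 a0/= lerNl (le_trans _ (asin_geNpi2 _))//.
by rewrite lerN2 ler_pdivrMr// ler_peMr ?pi_ge0// ler1n.
Qed.

Definition gross_witten_density (R : realType) (g t : R) : R :=
  g / pi * sin (t / 2) *
  Num.sqrt (sin (t / 2) ^+ 2 - cos (theta_g g / 2) ^+ 2) *
  \1_(`[pi - theta_g g, pi + theta_g g]%classic : set R) t.

(* The circle is parametrized by the angle in [0, 2pi]. *)
Definition gross_witten (R : realType) (g : R) (A : set (R * R)) : \bar R :=
  (\int[lebesgue_measure]_(t in `[0%R, (2 * pi)%R] `&` @expi R @^-1` A)
     (gross_witten_density g t)%:E)%E.

Section gross_witten_measure.
Variables (R : realType) (g : R).

Let density_ge0 (t : R) : t \in `[0, 2 * pi] -> 0 <= gross_witten_density g t.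
Proof.
rewrite in_itv/= => /andP[t0 t2]; rewrite /gross_witten_density.
have [g0|g0] := leP g 0.
  have -> : theta_g g = 0.
    rewrite /theta_g ler0_sqrtr ?invr_le0// -[X in asin X]sin0 sinK ?mulr0//.
    by rewrite in_itv/= oppr_le0 divr_ge0 ?pi_ge0.
  rewrite mul0r cos0 expr1n (_ : Num.sqrt _ = 0) ?mulr0 ?mul0r//.
  by apply: ler0_sqrtr; rewrite subr_le0 sin2cos2 lerBlDr lerDl sqr_ge0.
rewrite !mulr_ge0 ?invr_ge0 ?pi_ge0 ?sqrtr_ge0 ?(ltW g0)//.
by apply: sin_ge0_pi; rewrite divr_ge0//= ler_pdivrMr// mulrC.
Qed.

Let measurable_half : measurable_fun setT (fun t : R => sin (t / 2)).
Proof.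
apply: (@measurableT_comp _ _ _ _ _ _ (@sin R)).
  by apply: continuous_measurable_fun; exact: continuous_sin.
exact: measurable_funM.
Qed.

Let measurable_density :
  measurable_fun setT (EFin \o @gross_witten_density R g).
Proof.
apply/measurable_EFinP; rewrite /gross_witten_density.
apply: measurable_funM; last exact: measurable_indic.
apply: measurable_funM; first exact: measurable_funM.
apply: (@measurableT_comp _ _ _ _ _ _ (@Num.sqrt R)).
  by apply: continuous_measurable_fun; exact: sqrt_continuous.
apply: measurable_funB => //; exact: measurable_funX.
Qed.

Let measurable_expi : measurable_fun setT (@expi R).
Proof.
apply: measurable_fun_pair; apply: continuous_measurable_fun.
- exact: continuous_cos.
- exact: continuous_sin.
Qed.

Let gross_witten0 : gross_witten g set0 = 0%E.
Proof. by rewrite /gross_witten preimage_set0 setI0 integral_set0. Qed.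

Let gross_witten_ge0 A : (0 <= gross_witten g A)%E.
Proof.
by apply: integral_ge0 => t [+ _] /=; rewrite lee_fin => /density_ge0.
Qed.

Let gross_witten_sigma_additive : semi_sigma_additive (gross_witten g).
Proof.
move=> F mF tF mUF; rewrite /gross_witten preimage_bigcup setI_bigcupr.
have mpre k : measurable (`[0, 2 * pi] `&` @expi R @^-1` F k : set R).
  by apply: measurableI => //; rewrite -[X in measurable X]setTI; exact: measurable_expi.
rewrite ge0_integral_bigcup//=.
- by apply: is_cvg_ereal_nneg_natsum_cond => n _ _; exact: gross_witten_ge0.
- exact/measurable_funTS.
- by move=> t [k _ [+ _]] /=; rewrite lee_fin => /density_ge0.
- apply/trivIsetP => i j _ _ ij; rewrite setIACA setIid -preimage_setI.
  by move/trivIsetP : tF => ->//; rewrite preimage_set0 setI0.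
Qed.

HB.instance Definition _ := isMeasure.Build _ _ _ (gross_witten g)
  gross_witten0 gross_witten_ge0 gross_witten_sigma_additive.

End gross_witten_measure.

Definition sum_rule_term (R : realType) (g : R) (alpha alphag : nat -> R[i])
    (k : nat) : R :=
  - g * complex.Re (alpha k * (prev alpha k)^*%C - alphag k * (prev alphag k)^*%C)
  - ln ((1 - normc (alpha k) ^+ 2) / (1 - normc (alphag k) ^+ 2)).

(* Main.v *)
(* The summation by parts
     - g Re (a_k conj a_(k-1)) = (g/2) |a_k - a_(k-1)|^2
                                 - (g/2) (|a_k|^2 + |a_(k-1)|^2)
   turns the partial sums of [sum_rule_term g alpha alphag] into those of
   [excess g alpha] minus those of [excess g alphag], up to a bounded boundary
   term, where [excess] is (g/2) |a_k - a_(k-1)|^2 + (s - 1 - ln s) with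
   s = g (1 - |a_k|^2).  Both summands are nonnegative, and s - 1 - ln s is
   comparable to (s - 1)^2, i.e. to (|a_k| - |a|)^2, as soon as s stays away
   from 0: hence the equivalence, provided that |a_k| < 1 and that the excesses
   of the Gross-Witten coefficients are summable.

   The former holds because the zeros of the orthogonal polynomials lie in the
   open disk.  For the latter, the Gross-Witten measure is the semicircle law in
   the variable cos (theta / 2), so its coefficients are computed from the scaled
   Chebyshev polynomials p_n: the polynomials R_n with
   R_n (e^(i t)) = e^(i n t / 2) p_n (2 cos (t / 2)) are orthogonal to
   z, ..., z^(n-1), and (z - 1) Phi_n = R_(n+1) - (R_(n+1)(1) / R_n(1)) R_n.  This
   gives (1 - a_(n-1)) (1 + a_n) = 1 / g, a recursion that contracts
   geometrically to its fixed point. *)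

Require Import Defs.
From mathcomp Require Import all_boot all_order all_algebra.
From mathcomp Require Import complex.
From mathcomp Require Import all_classical all_reals all_analysis measurable_realfun.
From mathcomp Require Import ring lra zify.
Set Implicit Arguments.
Unset Strict Implicit.
Unset Printing Implicit Defensive.
Import Order.TTheory GRing.Theory Num.Theory.
Import ComplexField.Normc.
Import numFieldTopology.Exports numFieldNormedType.Exports.
Local Open Scope classical_set_scope.
Local Open Scope ring_scope.
Local Open Scope complex_scope.

(** * Partial sums of the sum rule *)

Lemma normc_sqrE (R : rcfType) (z : R[i]) :
  normc z ^+ 2 = complex.Re z ^+ 2 + complex.Im z ^+ 2.
Proof. by case: z => x y /=; rewrite sqr_sqrtr// addr_ge0// sqr_ge0. Qed.

Lemma normc_ge0 (R : rcfType) (z : R[i]) : 0 <= normc z.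
Proof. by case: z => x y /=; rewrite sqrtr_ge0. Qed.

Lemma normc_sqr_sub (R : rcfType) (z w : R[i]) :
  normc (z - w) ^+ 2 =
  normc z ^+ 2 + normc w ^+ 2 - 2 * complex.Re (z * w^*%C).
Proof. by rewrite !normc_sqrE; case: z w => [a b] [c d] /=; ring. Qed.

(** Throughout the proof, convergence of a nonnegative series is handled as a bound on its real
    partial sums; this is the bridge to the extended reals. *)
Lemma nneseries_lty (R : realType) (u : nat -> R) : (forall k, 0 <= u k) ->
  (\sum_(0 <= k <oo) (u k)%:E < +oo)%E <->
  exists M : R, forall n, \sum_(0 <= k < n) u k <= M.
Proof.
move=> u0; have u0' n : (0 <= n)%N -> true -> (0 <= (u n)%:E)%E by rewrite lee_fin.
split=> [uoo|[M uM]].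
  exists (fine (\sum_(0 <= k <oo) (u k)%:E)%E) => n.
  rewrite -lee_fin fineK; last by rewrite ge0_fin_numE// nneseries_ge0.
  by rewrite -sumEFin; exact: nneseries_lim_ge.
apply: (@le_lt_trans _ _ M%:E); last exact: ltry.
apply: lime_le; first exact: is_cvg_nneseries.
by near=> n; rewrite sumEFin lee_fin.
Unshelve. all: by end_near. Qed.

(** * Elementary estimates for s - 1 - ln s *)

Section log_gap.
Context {R : realType}.
Implicit Types s b : R.

(** The bound ln s <= s - 1 alone gives only nonnegativity. Applied to q = sqrt s it gives ln s = 2
    ln q <= 2 (q - 1), so s - 1 - ln s >= (q - 1)^2, while (s - 1)^2 = (q + 1)^2 (q - 1)^2 with q <=
    sqrt b. *)
Lemma sub1_ln_ge s b : 0 < s -> s <= b ->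
  (s - 1) ^+ 2 <= (Num.sqrt b + 1) ^+ 2 * (s - 1 - ln s).
Proof.
move=> s0 sb.
have q0 : 0 < Num.sqrt s by rewrite sqrtr_gt0.
have qb : Num.sqrt s <= Num.sqrt b by rewrite ler_wsqrtr.
have {1 2 3}-> : s = Num.sqrt s ^+ 2 by rewrite sqr_sqrtr// ltW.
set q := Num.sqrt s in q0 qb *; rewrite lnXn//.
have lnq : ln q <= q - 1.
  by rewrite -[X in ln X](subrKC 1) le_ln1Dx// ltrBDl subrr.
have h : (q - 1) ^+ 2 <= q ^+ 2 - 1 - ln q *+ 2 by rewrite mulr2n; nra.
apply: (@le_trans _ _ ((Num.sqrt b + 1) ^+ 2 * (q - 1) ^+ 2)); last first.
  by rewrite ler_wpM2l ?sqr_ge0.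
have -> : q ^+ 2 - 1 = (q + 1) * (q - 1) by ring.
by rewrite exprMn ler_wpM2r ?sqr_ge0// ler_sqr ?nnegrE; lra.
Qed.

Lemma sub1_ln_ge0 s : 0 < s -> 0 <= s - 1 - ln s.
Proof.
move=> s0; rewrite subr_ge0 -[X in ln X](subrKC 1) le_ln1Dx//.
by rewrite ltrBDl subrr.
Qed.

(** Nonnegativity at 1 / s reads ln s >= 1 - 1 / s, and s - 2 + 1 / s = (s - 1)^2 / s. *)
Lemma sub1_ln_le s : 0 < s -> s - 1 - ln s <= (s - 1) ^+ 2 / s.
Proof.
move=> s0; have := @sub1_ln_ge0 s^-1; rewrite invr_gt0 => /(_ s0).
rewrite lnV ?posrE// => h.
have -> : (s - 1) ^+ 2 / s = s - 2 + s^-1 by field; rewrite gt_eqF.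
by lra.
Qed.

End log_gap.

Definition excess (R : realType) (g : R) (alpha : nat -> R[i]) (k : nat) : R :=
  let s := g * (1 - normc (alpha k) ^+ 2) in
  g / 2 * normc (alpha k - Defs.prev alpha k) ^+ 2 + (s - 1 - ln s).

Section sum_rule.
Context {R : realType}.
Implicit Types (g a : R) (alpha : nat -> R[i]).

Lemma normc_lt1_sqr (z : R[i]) : normc z < 1 -> 0 < 1 - normc z ^+ 2.
Proof.
by move=> z1; rewrite subr_gt0 -(expr1n _ 2) ltr_sqr ?nnegrE ?normc_ge0.
Qed.

Lemma excess_ge0 g alpha k : 0 < g -> normc (alpha k) < 1 ->
  0 <= excess g alpha k.
Proof.
move=> g0 /normc_lt1_sqr a1; rewrite addr_ge0 ?sub1_ln_ge0 ?mulr_gt0//.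
by rewrite mulr_ge0 ?sqr_ge0 ?divr_ge0 ?(ltW g0).
Qed.

(** Expanding the squared difference in [excess] produces the real part; the constants g - 1 - ln g
    cancel between the two excesses, and the differences of squared moduli are left to telescope. *)
Lemma sum_rule_termE g alpha beta k : 0 < g ->
  normc (alpha k) < 1 -> normc (beta k) < 1 ->
  sum_rule_term g alpha beta k = excess g alpha k - excess g beta k
    + g / 2 * (normc (alpha k) ^+ 2 - normc (Defs.prev alpha k) ^+ 2)
    - g / 2 * (normc (beta k) ^+ 2 - normc (Defs.prev beta k) ^+ 2).
Proof.
move=> g0 /normc_lt1_sqr a1 /normc_lt1_sqr b1.
rewrite /sum_rule_term /excess !normc_sqr_sub ln_div ?posrE// !lnM ?posrE//.
rewrite [complex.Re (_ - _)](_ : _ =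
  complex.Re (alpha k * (Defs.prev alpha k)^*) - complex.Re (beta k * (Defs.prev beta k)^*)).
  by field.
by case: (alpha k * _) (beta k * _) => [? ?] [? ?].
Qed.

(** Both sequences take the value -1 at index -1, so the lower ends of the two telescoping sums
    cancel. *)
Lemma sum_rule_sum g alpha beta n : 0 < g ->
  (forall k, normc (alpha k) < 1) -> (forall k, normc (beta k) < 1) ->
  \sum_(0 <= k < n.+1) sum_rule_term g alpha beta k =
  \sum_(0 <= k < n.+1) excess g alpha k - \sum_(0 <= k < n.+1) excess g beta k
    + g / 2 * (normc (alpha n) ^+ 2 - normc (beta n) ^+ 2).
Proof.
move=> g0 a1 b1; elim: n => [|n ih].
  by rewrite !big_nat1 sum_rule_termE// ![Defs.prev _ 0]/=; field.
rewrite !(big_nat_recr n.+1)//= ih.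
by rewrite sum_rule_termE// ![Defs.prev _ n.+1]/=; field.
Qed.

Lemma bounded_sums_lin (u v w : nat -> R) (c d : R) : 0 <= c -> 0 <= d ->
  (forall k, w k <= c * u k + d * v k) ->
  (exists M, forall n, \sum_(0 <= k < n) u k <= M) ->
  (exists M, forall n, \sum_(0 <= k < n) v k <= M) ->
  exists M, forall n, \sum_(0 <= k < n) w k <= M.
Proof.
move=> c0 d0 wuv [M uM] [N vN]; exists (c * M + d * N) => n.
apply: (@le_trans _ _ (\sum_(0 <= k < n) (c * u k + d * v k))).
  by apply: ler_sum_nat => k _; exact: wuv.
by rewrite big_split/= -!mulr_sumr lerD ?ler_wpM2l.
Qed.

Lemma bounded_sums_tail (u v : nat -> R) (N : nat) :
  (forall k, 0 <= v k) -> (forall k, (N <= k)%N -> u k <= v k) ->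
  (exists M, forall n, \sum_(0 <= k < n) v k <= M) ->
  exists M, forall n, \sum_(0 <= k < n) u k <= M.
Proof.
move=> v0 uv [M vM]; exists (\sum_(0 <= k < N) `|u k| + M) => n.
(* The majorant adds |u_k| below N only, so the initial terms cost a fixed amount whatever n is. *)
apply: (@le_trans _ _ (\sum_(0 <= k < n) ((k < N)%N%:R * `|u k| + v k))).
  apply: ler_sum_nat => k _; have [kN|kN] := ltnP k N.
    by rewrite mul1r (le_trans (ler_norm _))// lerDl.
  by rewrite mul0r add0r uv.
rewrite big_split/= lerD//.
have [nN|Nn] := leqP n N.
  rewrite (big_cat_nat (leq0n n) nN)/= (@le_trans _ _ (\sum_(0 <= k < n) `|u k|))//.
    apply: ler_sum_nat => k /andP[_ kn].
    by rewrite (leq_trans kn nN) mul1r.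
  by rewrite lerDl sumr_ge0.
rewrite (big_cat_nat (leq0n N) (ltnW Nn))/=.
rewrite [X in _ + X]big_nat_cond [X in _ + X]big1 ?addr0; last first.
  by move=> k /andP[/andP[Nk _] _]; rewrite ltnNge Nk mul0r.
by apply: ler_sum_nat => k /andP[_ ->]; rewrite mul1r.
Qed.

Lemma bounded_sums_small (u : nat -> R) (e : R) : 0 < e ->
  (forall k, 0 <= u k) ->
  (exists M, forall n, \sum_(0 <= k < n) u k <= M) ->
  exists N, forall k, (N <= k)%N -> u k < e.
Proof.
move=> e0 u0 uM.
have : cvgn (series u).
  apply: nondecreasing_is_cvgn.
    by move=> m n mn; exact: nondecreasing_series.
  case: uM => M uM; exists M => _ [n _ <-]; exact: uM.
move=> /cvg_series_cvg_0 /cvgr0Pnorm_lt /(_ _ e0)[N _ uN].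
by exists N => k /uN; rewrite ger0_norm.
Qed.

(** With s_k = g (1 - |alpha_k|^2), the value of a^2 gives s_k - 1 = - g (|alpha_k| - |a|)
    (|alpha_k| + |a|). The bound s_k <= g yields one direction; the other needs s_k bounded below,
    which holds for large k. *)
Lemma excess_bounded g a alpha : 1 < g -> a ^+ 2 = 1 - g^-1 ->
  (forall k, normc (alpha k) < 1) ->
  (exists M, forall n, \sum_(0 <= k < n) excess g alpha k <= M) <->
  (exists M, forall n,
     \sum_(0 <= k < n) normc (alpha k.+1 - alpha k) ^+ 2 <= M) /\
  (exists M, forall n, \sum_(0 <= k < n) (normc (alpha k) - `|a|) ^+ 2 <= M).
Proof.
move=> g1 aE alpha1; have g0 : 0 < g by lra.
have a20 : 0 < a ^+ 2 by rewrite aE subr_gt0 invf_lt1.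
have a0 : 0 < `|a| by rewrite normr_gt0 -sqrf_eq0 gt_eqF.
have na2 : `|a| ^+ 2 = 1 - g^-1 by rewrite -normrX ger0_norm ?sqr_ge0.
have na1 : `|a| < 1.
  by rewrite -ltr_sqr ?nnegrE// na2 expr1n ltrBlDr ltrDl invr_gt0.
pose s k := g * (1 - normc (alpha k) ^+ 2).
have s0 k : 0 < s k by rewrite mulr_gt0// normc_lt1_sqr.
have sg k : s k <= g by rewrite /s -[leRHS]mulr1 ler_pM2l// gerBl sqr_ge0.
have sE k : s k - 1 = - g * (normc (alpha k) - `|a|) * (normc (alpha k) + `|a|).
  rewrite -mulrA -subr_sqr na2 /s mulrBr mulNr mulrBr mulrBr divff ?gt_eqF//; ring.
have nD k : 0 <= normc (alpha k) by exact: normc_ge0.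
split=> [exM|[DM aM]].
- split.
  + case: exM => M exM; exists (2 / g * M) => n.
    (* One more term is taken because the difference of indices k + 1 and k sits in the excess of
       index k + 1; the excess of index 0 is dropped. *)
    apply: (@le_trans _ _ (2 / g * \sum_(0 <= k < n.+1) excess g alpha k)).
      rewrite big_nat_recl// mulrDr mulr_sumr.
      rewrite -[leLHS]add0r lerD//.
        by rewrite mulr_ge0 ?divr_ge0 ?(ltW g0)// excess_ge0.
      apply: ler_sum_nat => k _; rewrite /excess/= mulrDr -[leLHS]addr0 lerD//.
        rewrite le_eqVlt; apply/orP; left; apply/eqP; field.
        by rewrite gt_eqF.
      by rewrite mulr_ge0 ?divr_ge0 ?(ltW g0)// sub1_ln_ge0// s0.
    by rewrite ler_wpM2l// divr_ge0// ltW.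
  (* The numerator comes from [sub1_ln_ge] with b = g, the denominator from |alpha_k| + |a| >=
     |a|. *)
  + pose c := (Num.sqrt g + 1) ^+ 2 / (g * `|a|) ^+ 2.
    apply: (@bounded_sums_lin (excess g alpha) (excess g alpha) _ c 0) => // [|k].
      by rewrite divr_ge0 ?sqr_ge0.
    rewrite mul0r addr0.
    have h := sub1_ln_ge (s0 k) (sg k).
    rewrite mulrAC ler_pdivlMr ?exprn_gt0 ?mulr_gt0//.
    apply: (@le_trans _ _ ((s k - 1) ^+ 2)).
      rewrite sE (_ : (_ * _ * _) ^+ 2 = (normc (alpha k) - `|a|) ^+ 2 *
        (g * (normc (alpha k) + `|a|)) ^+ 2); last by ring.
      rewrite ler_wpM2l ?sqr_ge0// ler_sqr ?nnegrE ?mulr_ge0 ?addr_ge0 ?(ltW g0)//.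
      by rewrite ler_pM2l// lerDr.
    apply: le_trans h _; rewrite ler_wpM2l ?sqr_ge0// /excess/= -/(s k) lerDr.
    by rewrite mulr_ge0 ?sqr_ge0// divr_ge0// ltW.
(* With this threshold, |alpha_k| is eventually at most the midpoint (1 + |a|) / 2 of |a| and 1, so
   s_k is at least the positive constant [b]. *)
- have /(bounded_sums_small (e := ((1 - `|a|) / 2) ^+ 2)) := aM.
  case=> [||N aN]; [by rewrite exprn_gt0// divr_gt0// subr_gt0|by move=> k; exact: sqr_ge0|].
  pose b := g * (1 - ((1 + `|a|) / 2) ^+ 2).
  have b0 : 0 < b.
    by rewrite mulr_gt0// subr_gt0 -(expr1n _ 2) ltr_sqr ?nnegrE; lra.
  have sb k : (N <= k)%N -> b <= s k.
    have q0 : 0 <= (1 + `|a|) / 2 by lra.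
    move=> /aN h; rewrite /b /s ler_pM2l// lerB// ler_sqr ?nnegrE//.
    rewrite leNgt; apply/negP => n1; move: h; rewrite ltNge => /negP; apply.
    by rewrite ler_sqr ?nnegrE; lra.
  (* The excess also contains the difference with index -1, that is |alpha_0 + 1|^2. *)
  have D1M : exists M, forall n,
      \sum_(0 <= k < n) normc (alpha k - Defs.prev alpha k) ^+ 2 <= M.
    case: DM => M DM; exists (normc (alpha 0%N + 1) ^+ 2 + M) => -[|n].
      by rewrite big_nil addr_ge0 ?sqr_ge0// (le_trans _ (DM 0%N))// big_nil.
    by rewrite big_nat_recl//= opprK lerD.
  apply: (@bounded_sums_lin (fun k => normc (alpha k - Defs.prev alpha k) ^+ 2)
    (fun k => s k - 1 - ln (s k)) _ (g / 2) 1) => //.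
  - by rewrite divr_ge0// ltW.
  - by move=> k; rewrite mul1r.
  (* The 4 bounds (|alpha_k| + |a|)^2, both moduli being less than 1, and 1 / b bounds 1 / s_k. *)
  - pose c := 4 * g ^+ 2 / b.
    have c0 : 0 <= c by rewrite divr_ge0 ?(ltW b0)// mulr_ge0// sqr_ge0.
    apply: (@bounded_sums_tail _ (fun k => c * (normc (alpha k) - `|a|) ^+ 2) N).
    + by move=> k; rewrite mulr_ge0// sqr_ge0.
    + move=> k Nk; apply: (le_trans (sub1_ln_le (s0 k))).
      apply: (@le_trans _ _ ((s k - 1) ^+ 2 / b)).
        by rewrite ler_wpM2l ?sqr_ge0// lef_pV2 ?posrE ?sb.
      rewrite /c [leRHS]mulrAC ler_pM2r ?invr_gt0// sE.
      rewrite (_ : (_ * _ * _) ^+ 2 = (g ^+ 2 * (normc (alpha k) - `|a|) ^+ 2) *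
        (normc (alpha k) + `|a|) ^+ 2); last by ring.
      rewrite -[leRHS]mulrA [leRHS]mulrC ler_wpM2l ?(mulr_ge0 (sqr_ge0 _) (sqr_ge0 _))//.
      rewrite (_ : 4 = 2 ^+ 2 :> R); last by ring.
      rewrite ler_sqr ?nnegrE ?addr_ge0//.
      rewrite (_ : 2 = 1 + 1 :> R)// lerD// ltW//.
    + case: aM => M aM; exists (c * M) => n.
      by rewrite -mulr_sumr ler_wpM2l.
Qed.

End sum_rule.

(** * Orthogonal polynomials of a measure on the circle *)

Lemma normr_Re_le (R : rcfType) (z : R[i]) : `|complex.Re z| <= normc z.
Proof.
by case: z => x y /=; rewrite -sqrtr_sqr ler_wsqrtr// lerDl sqr_ge0.
Qed.

Lemma normr_Im_le (R : rcfType) (z : R[i]) : `|complex.Im z| <= normc z.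
Proof.
by case: z => x y /=; rewrite -sqrtr_sqr ler_wsqrtr// lerDr sqr_ge0.
Qed.

Lemma normc_conj (R : rcfType) (z : R[i]) : normc (z^*%C) = normc z.
Proof. by case: z => x y /=; rewrite sqrrN. Qed.

Lemma conjc_mul_normc (R : rcfType) (z : R[i]) :
  z^*%C * z = (normc z ^+ 2)%:C.
Proof.
rewrite normc_sqrE; case: z => x y /=; apply/eqP; rewrite eq_complex/=.
by apply/andP; split; apply/eqP; ring.
Qed.

Lemma normc_prod_lt1 (R : rcfType) (r : seq R[i]) : r != [::] ->
  (forall z, z \in r -> normc z < 1) -> normc (\prod_(z <- r) z) < 1.
Proof.
elim: r => // x r ih _ xr1; rewrite big_cons normcM.
have x1 : normc x < 1 by rewrite xr1// mem_head.
have [->|r0] := eqVneq r [::]; first by rewrite big_nil normc1 mulr1.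
have r1 : normc (\prod_(z <- r) z) < 1.
  by apply: ih => // z zr; rewrite xr1// in_cons zr orbT.
apply: le_lt_trans r1; rewrite ler_piMl ?normc_ge0//; exact: ltW.
Qed.

(* Such functions are integrable for every finite measure carried by the circle. *)
Definition circle_fun (R : realType) (f : R * R -> R[i]) : Prop :=
  [/\ measurable_fun setT (fun z => complex.Re (f z)),
      measurable_fun setT (fun z => complex.Im (f z)) &
      exists K : R, forall z, unit_circle z -> normc (f z) <= K].

Section circle_fun.
Context {R : realType}.
Implicit Types f g : R * R -> R[i].

Lemma circle_fun_toC : circle_fun (@toC R).
Proof.
split; [exact: measurable_fst|exact: measurable_snd|].
by exists 1 => z; rewrite /unit_circle/= => ->.
Qed.

Lemma circle_fun_cst (c : R[i]) : circle_fun (fun=> c).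
Proof.
by split; [exact: measurable_cst|exact: measurable_cst|exists (normc c)].
Qed.

Lemma circle_funD f g : circle_fun f -> circle_fun g ->
  circle_fun (fun z => f z + g z).
Proof.
move=> [rf mf [K fK]] [rg mg [L gL]]; split.
- rewrite [X in measurable_fun _ X](_ : _ =
    (fun z => complex.Re (f z) + complex.Re (g z))).
    exact: measurable_funD.
  by apply/funext => z; case: (f z) (g z) => [? ?] [].
- rewrite [X in measurable_fun _ X](_ : _ =
    (fun z => complex.Im (f z) + complex.Im (g z))).
    exact: measurable_funD.
  by apply/funext => z; case: (f z) (g z) => [? ?] [].
- by exists (K + L) => z zS; rewrite (le_trans (le_normcD _ _))// lerD ?fK ?gL.
Qed.

Lemma circle_funM f g : circle_fun f -> circle_fun g ->
  circle_fun (fun z => f z * g z).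
Proof.
move=> [rf mf [K fK]] [rg mg [L gL]]; split.
- rewrite [X in measurable_fun _ X](_ : _ = (fun z =>
    complex.Re (f z) * complex.Re (g z) - complex.Im (f z) * complex.Im (g z))).
    by apply: measurable_funB; exact: measurable_funM.
  by apply/funext => z; case: (f z) (g z) => [? ?] [].
- rewrite [X in measurable_fun _ X](_ : _ = (fun z =>
    complex.Re (f z) * complex.Im (g z) + complex.Im (f z) * complex.Re (g z))).
    by apply: measurable_funD; exact: measurable_funM.
  by apply/funext => z; case: (f z) (g z) => [? ?] [].
- exists (K * L) => z zS.
  by rewrite normcM ler_pM ?fK ?gL ?normc_ge0.
Qed.

Lemma circle_fun_conj f : circle_fun f -> circle_fun (fun z => (f z)^*%C).
Proof.
move=> [rf mf [K fK]]; split.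
- rewrite [X in measurable_fun _ X](_ : _ = (fun z => complex.Re (f z)))//.
  by apply/funext => z; case: (f z).
- rewrite [X in measurable_fun _ X](_ : _ = (fun z => - complex.Im (f z))).
    exact: measurableT_comp.
  by apply/funext => z; case: (f z).
- by exists K => z zS; rewrite normc_conj fK.
Qed.

Lemma circle_fun_horner (p : {poly R[i]}) : circle_fun (fun z => p.[toC z]).
Proof.
elim/poly_ind: p => [|p c ih].
  rewrite (_ : (fun z => _) = (fun=> 0)); first exact: circle_fun_cst.
  by apply/funext => z; rewrite horner0.
rewrite (_ : (fun z => _) = (fun z => p.[toC z] * toC z + c)).
  apply: circle_funD; last exact: circle_fun_cst.
  by apply: circle_funM => //; exact: circle_fun_toC.
by apply/funext => z; rewrite hornerMXaddC.
Qed.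

Lemma measurable_unit_circle : measurable (@unit_circle R).
Proof.
rewrite [X in measurable X](_ : _ =
  (fun z : R * R => z.1 ^+ 2 + z.2 ^+ 2) @^-1` [set 1]); last first.
  apply/seteqP; split=> z /=; rewrite /unit_circle/= => h.
    have /(congr1 (fun x => x ^+ 2)) := h.
    by rewrite sqr_sqrtr ?addr_ge0 ?sqr_ge0// expr1n.
  by rewrite h sqrtr1.
rewrite -[X in measurable X]setTI.
have mh : measurable_fun setT (fun z : R * R => z.1 ^+ 2 + z.2 ^+ 2).
  by apply: measurable_funD; apply: measurable_funX;
    [exact: measurable_fst|exact: measurable_snd].
exact: mh.
Qed.

(** The two parts go through the induction together, since multiplication by z mixes them. *)
Lemma continuous_horner_toC (p : {poly R[i]}) :
  continuous (fun z => complex.Re p.[toC z]) /\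
  continuous (fun z => complex.Im p.[toC z]).
Proof.
elim/poly_ind: p => [|p c [ihr ihi]].
  rewrite (_ : (fun z => complex.Re _) = (fun=> 0)); last first.
    by apply/funext => z; rewrite horner0.
  rewrite (_ : (fun z => complex.Im _) = (fun=> 0)); last first.
    by apply/funext => z; rewrite horner0.
  by split=> z; exact: cvg_cst.
rewrite (_ : (fun z => complex.Re _) = (fun z =>
   complex.Re p.[toC z] * z.1 - complex.Im p.[toC z] * z.2 + complex.Re c)); last first.
  apply/funext => z; rewrite hornerMXaddC /toC.
  by case: (p.[_]) => [? ?]; case: (c).
rewrite (_ : (fun z => complex.Im _) = (fun z =>
   complex.Re p.[toC z] * z.2 + complex.Im p.[toC z] * z.1 + complex.Im c)); last first.
  apply/funext => z; rewrite hornerMXaddC /toC.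
  by case: (p.[_]) => [? ?]; case: (c).
split=> z.
- apply: cvgD; last exact: cvg_cst.
  apply: cvgB; apply: cvgM; [exact: ihr|exact: cvg_fst|exact: ihi|exact: cvg_snd].
- apply: cvgD; last exact: cvg_cst.
  apply: cvgD; apply: cvgM; [exact: ihr|exact: cvg_snd|exact: ihi|exact: cvg_fst].
Qed.

Lemma finite_set_roots (p : {poly R[i]}) : p != 0 ->
  finite_set [set z : R * R | p.[toC z] = 0].
Proof.
move=> p0; have [r pE] := closed_field_poly_normal p.
have fr : finite_set [set` r] by exact: finite_seq.
have : finite_set (@toC R @^-1` [set` r]).
  by apply: finite_preimage fr => -[a b] [c d] _ _ [-> ->].
apply: sub_finite_set => z/= /eqP; rewrite -[_ == 0]/(root p (toC z)) pE.
by rewrite rootZ ?lead_coef_eq0// root_prod_XsubC.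
Qed.

End circle_fun.

(** * The Hermitian form of a finite measure carried by the circle *)

Section circle_measure.
Context {R : realType} (mu : {measure set (R * R) -> \bar R}).
Hypothesis mu_fin : (mu setT < +oo)%E.
Hypothesis mu_circle : mu (~` @unit_circle R) = 0%E.
Implicit Types (f g : R * R -> R[i]) (p q r : {poly R[i]}).

Lemma circle_integrable (h : R * R -> R) (K : R) : measurable_fun setT h ->
  (forall z, unit_circle z -> `|h z| <= K) -> mu.-integrable setT (EFin \o h).
Proof.
move=> mh hK.
apply/(negligible_integrable (measurableC measurable_unit_circle) measurableT) => //.
  exact/measurable_EFinP.
rewrite setTD setCK; apply: measurable_bounded_integrable.
- exact: measurable_unit_circle.
- apply: le_lt_trans mu_fin; apply: le_measure; rewrite ?inE//.
  exact: measurable_unit_circle.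
- exact: measurable_funTS.
- exists K; split; first exact: num_real.
  by move=> x Kx z /= /hK /le_trans; apply; exact: ltW.
Qed.

Lemma circle_fun_integrable f : circle_fun f ->
  mu.-integrable setT (EFin \o (fun z => complex.Re (f z))) /\
  mu.-integrable setT (EFin \o (fun z => complex.Im (f z))).
Proof.
move=> [rf mf [K fK]]; split; apply: (@circle_integrable _ K) => // z /fK.
  exact/le_trans/normr_Re_le.
exact/le_trans/normr_Im_le.
Qed.

Lemma cintegralD f g : circle_fun f -> circle_fun g ->
  cintegral mu (fun z => f z + g z) = cintegral mu f + cintegral mu g.
Proof.
move=> /circle_fun_integrable[rf mf] /circle_fun_integrable[rg mg].
rewrite /cintegral.
under [X in Complex X _]eq_Rintegral => z _.
  rewrite (_ : complex.Re _ = complex.Re (f z) + complex.Re (g z)); last first.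
    by case: (f z) (g z) => [? ?] [].
  over.
under [X in Complex _ X]eq_Rintegral => z _.
  rewrite (_ : complex.Im _ = complex.Im (f z) + complex.Im (g z)); last first.
    by case: (f z) (g z) => [? ?] [].
  over.
by rewrite !RintegralD.
Qed.

Lemma cintegralZ (c : R[i]) f : circle_fun f ->
  cintegral mu (fun z => c * f z) = c * cintegral mu f.
Proof.
move=> /circle_fun_integrable[rf mf].
have iZ (a : R) (h : R * R -> R) : mu.-integrable setT (EFin \o h) ->
    mu.-integrable setT (EFin \o (fun z => a * h z)).
  by move=> ih; have := integrableZl measurableT a ih.
case: c => a b; rewrite /cintegral.
under [X in Complex X _]eq_Rintegral => z _.
  rewrite (_ : complex.Re _ = a * complex.Re (f z) - b * complex.Im (f z)); last first.
    by case: (f z).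
  over.
under [X in Complex _ X]eq_Rintegral => z _.
  rewrite (_ : complex.Im _ = a * complex.Im (f z) + b * complex.Re (f z)); last first.
    by case: (f z).
  over.
by rewrite RintegralB ?RintegralD ?RintegralZl//; apply: iZ.
Qed.

Lemma cintegral_conj f : circle_fun f ->
  cintegral mu (fun z => (f z)^*%C) = (cintegral mu f)^*%C.
Proof.
move=> /circle_fun_integrable[rf mf]; rewrite /cintegral/=.
under [X in Complex X _]eq_Rintegral => z _.
  rewrite (_ : complex.Re _ = complex.Re (f z)); last by case: (f z).
  over.
under [X in Complex _ X]eq_Rintegral => z _.
  rewrite (_ : complex.Im _ = -1 * complex.Im (f z)); last first.
    by rewrite mulN1r; case: (f z).
  over.
by rewrite RintegralZl// mulN1r.
Qed.

Lemma Rintegral_eq_circle (h k : R * R -> R) :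
  measurable_fun setT h -> measurable_fun setT k ->
  (forall z, unit_circle z -> h z = k z) ->
  Rintegral mu setT h = Rintegral mu setT k.
Proof.
move=> mh mk hk; congr fine; apply: ae_eq_integral => //.
- exact/measurable_EFinP.
- exact/measurable_EFinP.
- exists (~` @unit_circle R); split=> //.
    exact: measurableC measurable_unit_circle.
  by move=> z /= /not_implyP[_ hkz] Sz; apply: hkz; rewrite hk.
Qed.

Lemma eq_cintegral_circle f g : circle_fun f -> circle_fun g ->
  (forall z, unit_circle z -> f z = g z) -> cintegral mu f = cintegral mu g.
Proof.
move=> [rf mf _] [rg mg _] fg; congr Complex;
  by apply: Rintegral_eq_circle => // z Sz; rewrite fg.
Qed.

Lemma circle_fun_inner p q : circle_fun (fun z => (p.[toC z])^*%C * q.[toC z]).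
Proof.
by apply: circle_funM; [apply: circle_fun_conj|]; exact: circle_fun_horner.
Qed.

Lemma innerDr p q r : inner mu p (q + r) = inner mu p q + inner mu p r.
Proof.
rewrite /inner -cintegralD; try exact: circle_fun_inner.
by congr cintegral; apply/funext => z; rewrite hornerD mulrDr.
Qed.

Lemma innerZr p (c : R[i]) q : inner mu p (c *: q) = c * inner mu p q.
Proof.
rewrite /inner -cintegralZ; last exact: circle_fun_inner.
by congr cintegral; apply/funext => z; rewrite hornerZ mulrCA.
Qed.

Lemma inner_conj p q : inner mu q p = (inner mu p q)^*%C.
Proof.
rewrite /inner -cintegral_conj; last exact: circle_fun_inner.
by congr cintegral; apply/funext => z; rewrite rmorphM/= conjcK mulrC.
Qed.

Lemma inner0r p : inner mu p 0 = 0.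
Proof. by rewrite -(scale0r 0) innerZr mul0r. Qed.

Lemma innerBr p q r : inner mu p (q - r) = inner mu p q - inner mu p r.
Proof. by rewrite innerDr -scaleN1r innerZr mulN1r. Qed.

Lemma innerDl p q r : inner mu (p + q) r = inner mu p r + inner mu q r.
Proof. by rewrite (inner_conj r) innerDr rmorphD/= (inner_conj r p) (inner_conj r q). Qed.

Lemma innerZl (c : R[i]) p q : inner mu (c *: p) q = c^*%C * inner mu p q.
Proof. by rewrite (inner_conj q) innerZr rmorphM/= (inner_conj q p). Qed.

Lemma innerBl p q r : inner mu (p - q) r = inner mu p r - inner mu q r.
Proof. by rewrite (inner_conj r) innerBr rmorphB/= (inner_conj r p) (inner_conj r q). Qed.

(** Multiplication by z is an isometry because |z| = 1 almost everywhere. *)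
Lemma innerMX p q : inner mu (p * 'X) (q * 'X) = inner mu p q.
Proof.
apply: eq_cintegral_circle; try exact: circle_fun_inner.
move=> z Sz; rewrite !hornerMX rmorphM/= mulrACA (conjc_mul_normc (toC z)).
by rewrite Sz expr1n mulr1.
Qed.

Lemma inner_norm p : inner mu p p =
  (Rintegral mu setT (fun z => normc p.[toC z] ^+ 2))%:C.
Proof.
rewrite /inner /cintegral; congr Complex.
  by apply: eq_Rintegral => z _; rewrite conjc_mul_normc.
under eq_Rintegral => z _ do rewrite conjc_mul_normc/=.
by rewrite /Rintegral integral0.
Qed.

Lemma inner_ge0 p : 0 <= complex.Re (inner mu p p).
Proof.
by rewrite inner_norm/=; apply: Rintegral_ge0 => z _; exact: sqr_ge0.
Qed.

(** If the integral of |p|^2 vanishes, then |p|^2 is zero off a null set. Around a support point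
    where p is nonzero, the open set |p|^2 > 0 would be contained in that null set; so the support
    lies among the finitely many zeros of p unless p = 0. *)
Lemma inner_eq0 p : infinite_set (msupport mu) -> inner mu p p = 0 -> p = 0.
Proof.
move=> supp; rewrite inner_norm => -[] /eqP; have [//|p0 I0] := eqVneq p 0.
pose h z := normc p.[toC z] ^+ 2.
have hE : h = fun z => complex.Re p.[toC z] ^+ 2 + complex.Im p.[toC z] ^+ 2.
  by apply/funext => z; rewrite /h normc_sqrE.
have [mr mi [K pK]] := circle_fun_horner p.
have mh : measurable_fun setT h.
  by rewrite hE; apply: measurable_funD; exact: measurable_funX.
have ih : mu.-integrable setT (EFin \o h).
  apply: (@circle_integrable _ (K ^+ 2)) => // z /pK zK.
  rewrite ger0_norm ?sqr_ge0// /h ler_sqr ?nnegrE ?normc_ge0//.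
  exact: le_trans (normc_ge0 _) zK.
have : (\int[mu]_z `|(h z)%:E| = 0)%E.
  under eq_integral => z _ do rewrite gee0_abs ?lee_fin ?sqr_ge0//.
  rewrite -[LHS]fineK; last exact: integrable_fin_num.
  by move/eqP : I0 => I0; congr EFin.
move=> /(ae_eq_integral_abs _ measurableT)[|N [mN N0 hN]].
  exact/measurable_EFinP.
exfalso; apply: supp; apply: sub_finite_set (finite_set_roots p0) => z zs/=.
apply: contrapT => pz.
have [cr ci] := continuous_horner_toC p.
have ch : continuous h.
  by rewrite hE => w; apply: cvgD; apply: cvgM; (exact: cr || exact: ci).
pose U := h @^-1` [set x | 0 < x].
have oU : open U by apply: open_comp => // w _; exact: ch.
have Uz : U z.
  rewrite /U/= lt_neqAle sqr_ge0 andbT eq_sym sqrf_eq0; apply/eqP => /eq0_normc.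
  exact: pz.
have mU : measurable U.
  rewrite -[X in measurable X]setTI; apply: mh => //.
  by rewrite -set_itvoy; exact: measurable_itv.
have := zs U oU Uz; rewrite ltNge => /negP; apply.
rewrite -N0; apply: le_measure; rewrite ?inE// => w; rewrite /U/= => w0.
by apply: hN => /(_ I)[] /eqP; rewrite gt_eqF.
Qed.

End circle_measure.

(** * Zeros and uniqueness of the orthogonal polynomials *)

Section orthogonal_polynomials.
Context {R : realType} (mu : {measure set (R * R) -> \bar R}).
Hypothesis mu_fin : (mu setT < +oo)%E.
Hypothesis mu_circle : mu (~` @unit_circle R) = 0%E.
Hypothesis mu_infinite : infinite_set (msupport mu).

Let innerE := (innerDr mu_fin mu_circle, innerZr mu_fin mu_circle,
  innerDl mu_fin mu_circle, innerZl mu_fin mu_circle, innerBr mu_fin mu_circle).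

(** Subtracting from q its leading coefficient times the [Phi j] of the same degree lowers the size,
    and the subtracted term is orthogonal to [Phi n]. *)
Lemma monic_orthogonal_low Phi n (q : {poly R[i]}) : monic_orthogonal mu Phi ->
  (size q <= n)%N -> inner mu (Phi n) q = 0.
Proof.
move=> [mPhi sPhi oPhi]; move: {2}(size q) (leqnn (size q)) => m.
elim: m q => [|m ih] q qm qn.
  by move: qm; rewrite leqn0 size_poly_eq0 => /eqP ->; rewrite inner0r.
have [q0|q0] := eqVneq q 0; first by rewrite q0 inner0r.
have sq : (0 < size q)%N by rewrite size_poly_gt0.
set j := (size q).-1; set c := lead_coef q.
have qE : q = c *: Phi j + (q - c *: Phi j) by rewrite addrC subrK.
have sr : (size (q - c *: Phi j)%R < size q)%N.
  rewrite -(prednK sq) ltnS; apply/leq_sizeP => i; rewrite -/j leq_eqVlt.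
  rewrite coefB coefZ => /predU1P[<-|ji].
    have := monicP (mPhi j); rewrite /lead_coef sPhi/= => ->.
    by rewrite mulr1 subrr.
  rewrite !nth_default ?mulr0 ?subrr// ?sPhi//.
  by rewrite -(prednK sq).
rewrite qE (innerDr mu_fin mu_circle) (innerZr mu_fin mu_circle) oPhi ?mulr0 ?add0r; last first.
  by rewrite neq_ltn /j prednK// qn orbT.
by apply: ih; [rewrite -ltnS (leq_trans sr)|rewrite (leq_trans (ltnW sr))].
Qed.

(** Write Phi_n = (X - z) p, so that X p = Phi_n + z p with p orthogonal to Phi_n. By the isometry
    and Pythagoras, ||p||^2 = ||Phi_n||^2 + |z|^2 ||p||^2, and ||Phi_n|| > 0 excludes |z| >= 1. *)
Lemma orthogonal_root_lt1 Phi n (z : R[i]) : monic_orthogonal mu Phi ->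
  root (Phi n) z -> normc z < 1.
Proof.
move=> oPhi; have [mPhi sPhi _] := oPhi; move=> /factor_theorem[p PhiE].
have p0 : p != 0.
  by apply: contraTneq (mPhi n) => p0; rewrite PhiE p0 mul0r monicE lead_coef0 eq_sym oner_eq0.
have sp : (size p <= n)%N.
  have := sPhi n; rewrite PhiE size_Mmonic ?monicXsubC// size_XsubC addn2/=.
  by case=> ->.
have XpE : p * 'X = Phi n + z *: p.
  by rewrite PhiE mulrBr -mul_polyC [z%:P * p]mulrC subrK.
have low := monic_orthogonal_low oPhi sp.
have low' : inner mu p (Phi n) = 0 by rewrite inner_conj// low conjc0.
have nPhi : 0 < complex.Re (inner mu (Phi n) (Phi n)).
  rewrite lt_neqAle inner_ge0// andbT; apply/eqP => /esym h.
  have : Phi n = 0.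
    by apply: (inner_eq0 mu_fin) => //; move: h; rewrite !inner_norm/= => ->.
  by move=> Phi0; have := sPhi n; rewrite Phi0 size_poly0.
have := innerMX mu_circle p p; rewrite XpE !innerE low low'.
rewrite !mulr0 addr0 add0r mulrA => /(congr1 (@complex.Re R)).
rewrite [z * _]mulrC conjc_mul_normc !inner_norm/= in nPhi *.
rewrite mulr0 subr0 => h.
rewrite ltNge; apply/negP => z1.
have z21 : 1 <= normc z ^+ 2 by rewrite -[1](expr1n _ 2) ler_sqr ?nnegrE ?normc_ge0.
have p00 : 0 <= Rintegral mu setT (fun w => normc p.[toC w] ^+ 2).
  by apply: Rintegral_ge0 => w _; exact: sqr_ge0.
have := ler_wpM2r p00 z21.
by rewrite mul1r -[leLHS]h gerDr leNgt nPhi.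
Qed.

(** The modulus of Phi_(k+1)(0) is the product of the moduli of its zeros, a nonempty product since
    the degree is k + 1. *)
Lemma verblunsky_lt1 alpha k : verblunsky mu alpha -> normc (alpha k) < 1.
Proof.
move=> [Phi oPhi ->]; have [mPhi sPhi _] := oPhi.
rewrite -[normc _]/(normc _) normcN normc_conj.
have [r rE] := closed_field_poly_normal (Phi k.+1).
have r0 : r != [::].
  apply: contra_eq_neq (sPhi k.+1) => r0; rewrite rE r0 big_nil.
  by rewrite (monicP (mPhi _)) scale1r size_poly1.
have rE' := rE; move: rE; rewrite (monicP (mPhi _)) scale1r => rE.
rewrite rE horner_prod.
rewrite (eq_bigr (fun z => -1 * z)); last by move=> z _; rewrite hornerXsubC sub0r mulN1r.
rewrite big_split/= normcM [X in X * _](_ : _ = 1); last first.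
  by elim: (r) => [|x t ih]; rewrite ?big_nil ?normc1// big_cons normcM ih normcN normc1 mulr1.
rewrite mul1r; apply: normc_prod_lt1 => // z zr.
by apply: (@orthogonal_root_lt1 _ k.+1 z oPhi); rewrite rE root_prod_XsubC.
Qed.

(** The difference has degree less than n, so it is orthogonal to both polynomials and hence to
    itself. *)
Lemma monic_orthogonal_unique Phi (Psi : {poly R[i]}) n :
  monic_orthogonal mu Phi -> Psi \is monic -> size Psi = n.+1 ->
  (forall j, (j < n)%N -> inner mu Psi 'X^j = 0) -> Phi n = Psi.
Proof.
move=> oPhi mPsi sPsi oPsi; have [mPhi sPhi _] := oPhi.
have sd : (size (Phi n - Psi)%R <= n)%N.
  apply/leq_sizeP => i; rewrite leq_eqVlt coefB => /predU1P[<-|ni].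
    have := monicP (mPhi n); have := monicP mPsi.
    by rewrite /lead_coef sPhi sPsi/= => -> ->; rewrite subrr.
  by rewrite !nth_default ?subrr// ?sPhi ?sPsi.
have lowPsi (q : {poly R[i]}) : (size q <= n)%N -> inner mu Psi q = 0.
  move=> qn; rewrite -(coefK q) poly_def.
  apply: (big_ind (fun q => inner mu Psi q = 0)) => [|x y xo yo|i _].
  - exact: inner0r.
  - by rewrite innerDr// xo yo addr0.
  - by rewrite innerZr// oPsi ?mulr0// (leq_trans _ qn).
apply/eqP; rewrite -subr_eq0; apply/eqP; apply: (inner_eq0 mu_fin) => //.
rewrite innerDl// -scaleN1r innerZl// scaleN1r lowPsi// mulr0 addr0.
exact: monic_orthogonal_low.
Qed.

End orthogonal_polynomials.

(** * Chebyshev and para-orthogonal polynomials *)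

(* Monic Chebyshev polynomials of the second kind, scaled so that they are
   orthogonal for the semicircle law on [-2 sqrt A, 2 sqrt A]. *)
Fixpoint cheb (R : nzRingType) (A : R) (n : nat) : {poly R} :=
  if n is m.+1 then
    if m is k.+1 then 'X * cheb A m - A *: cheb A k else 'X
  else 1.

(* [para A n] is [z^(n/2) cheb A n] at [z^(1/2) + z^(-1/2)]. *)
Fixpoint para (R : nzRingType) (A : R) (n : nat) : {poly R} :=
  if n is m.+1 then
    if m is k.+1 then ('X + 1) * para A m - A *: ('X * para A k) else 'X + 1
  else 1.

(* [riccati A n] is the ratio [para A n.+1] / [para A n] at 1, that is
   [1 - alpha_(n - 1)] for the Gross-Witten coefficients when [A = 1 / g]. *)
Fixpoint riccati (F : unitRingType) (A : F) (n : nat) : F :=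
  if n is m.+1 then 2 - A / riccati A m else 2.

(** The quotient of [para A n.+1 - riccati A n *: para A n] by X - 1, given by a recursion instead
    of a division; for A = 1 / g these are the orthogonal polynomials of the Gross-Witten
    measure. *)
Fixpoint opuc (F : unitRingType) (A : F) (n : nat) : {poly F} :=
  if n is m.+1 then
    para A m.+1 - A *: para A m + (A / riccati A m) *: opuc A m
  else 1.

Lemma nat_ind2 (P : nat -> Prop) : P 0%N -> P 1%N ->
  (forall n, P n -> P n.+1 -> P n.+2) -> forall n, P n.
Proof.
move=> P0 P1 Pn n; suff : P n /\ P n.+1 by case.
by elim: n => // n [ihn ihn1]; split => //; exact: Pn.
Qed.

Section cheb.
Context {R : comNzRingType} (A : R).

Lemma chebSS n : cheb A n.+2 = 'X * cheb A n.+1 - A *: cheb A n.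
Proof. by []. Qed.

(** The scaled form of the classical derivative formula for Chebyshev polynomials of the second
    kind. The companion identity in the proof is the formula at n + 1 with [cheb A n.+2] eliminated;
    carrying it along closes the induction. *)
Lemma cheb_deriv n :
  ((4 * A)%:P - 'X ^+ 2) * (cheb A n)^`() =
  n.+2%:R *: ('X * cheb A n) - (2 * n.+1)%:R *: cheb A n.+1.
Proof.
suff : ((4 * A)%:P - 'X ^+ 2) * (cheb A n)^`() =
    n.+2%:R *: ('X * cheb A n) - (2 * n.+1)%:R *: cheb A n.+1 /\
  ((4 * A)%:P - 'X ^+ 2) * (cheb A n.+1)^`() =
    (2 * A * n.+2%:R) *: cheb A n - n.+1%:R *: ('X * cheb A n.+1) by case.
elim: n => [|n [ih ih1]].
  by split; rewrite /= ?derivX ?derivC -?mul_polyC !rmorphM/= ?polyC_natr; ring.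
split.
  rewrite ih1 chebSS -!mul_polyC !rmorphM/= !polyC_natr.
  by ring.
rewrite chebSS derivB derivM derivX mul1r derivZ -!mul_polyC.
rewrite mulrBr mulrDr [X in _ + X - _]mulrCA ih1.
rewrite [X in _ - X]mulrCA ih -!mul_polyC !rmorphM/= !polyC_natr.
by ring.
Qed.

End cheb.

Section para.
Context {F : fieldType} (A : F).

Lemma paraSS n : para A n.+2 = ('X + 1) * para A n.+1 - A *: ('X * para A n).
Proof. by []. Qed.

Lemma monicD_lt (p q : {poly F}) : p \is monic -> (size q < size p)%N ->
  p + q \is monic /\ size (p + q) = size p.
Proof.
by move=> mp qp; rewrite size_polyDl// monicE lead_coefDl// (monicP mp).
Qed.

Lemma para_monic n : para A n \is monic /\ size (para A n) = n.+1.
Proof.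
have X1 : 'X + 1 \is @monic F /\ size ('X + 1 : {poly F}) = 2%N.
  have -> : 'X + 1 = 'X - (-1)%:P :> {poly F} by rewrite polyCN opprK.
  by rewrite monicXsubC size_XsubC.
have [mX1 sX1] := X1; elim/nat_ind2: n => [||n [mn sn] [mn1 sn1]] //.
- by rewrite monic1 size_poly1.
- have mX : ('X + 1) * para A n.+1 \is monic by rewrite monicMl.
  have sX : size (('X + 1) * para A n.+1) = n.+3.
    by rewrite size_Mmonic// ?monic_neq0// sX1 sn1.
  rewrite paraSS; have := @monicD_lt _ (- (A *: ('X * para A n))) mX.
  rewrite sX; apply; rewrite size_polyN (leq_ltn_trans (size_scale_leq _ _))//.
  by rewrite mulrC size_mulX ?sn// monic_neq0.
Qed.

Lemma para_horner0 n : (para A n).[0] = 1.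
Proof.
elim/nat_ind2: n => [||n _ ih]; first by rewrite hornerE.
  by rewrite /= !hornerE.
by rewrite paraSS !hornerE ih /= mulr0 mul0r subr0.
Qed.

Hypothesis riccati_neq0 : forall n, riccati A n != 0.

Lemma opucS n : opuc A n.+1 =
  para A n.+1 - A *: para A n + (A / riccati A n) *: opuc A n.
Proof. by []. Qed.

Lemma riccatiS n : riccati A n.+1 = 2 - A / riccati A n.
Proof. by []. Qed.

Lemma opuc_monic n : opuc A n \is monic /\ size (opuc A n) = n.+1.
Proof.
elim: n => [|n [mn sn]]; first by rewrite monic1 size_poly1.
have [mp sp] := para_monic n.+1; have [_ sp'] := para_monic n.
rewrite opucS -addrA -sp; apply: monicD_lt => //; rewrite sp.
rewrite (leq_ltn_trans (size_polyD _ _))// gtn_max size_polyN.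
by rewrite !(leq_ltn_trans (size_scale_leq _ _)) ?sn ?sp'.
Qed.

Lemma opuc_horner0 n : (opuc A n).[0] = riccati A n - 1.
Proof.
elim: n => [|n ih]; first by rewrite hornerE/=; ring.
rewrite opucS riccatiS !hornerD hornerN !hornerZ !para_horner0 ih.
by field.
Qed.

Lemma opuc_mulXsub1 n :
  ('X - 1) * opuc A n = para A n.+1 - riccati A n *: para A n.
Proof.
elim: n => [|n ih].
  by rewrite mulr1 /= -mul_polyC polyC_natr; ring.
rewrite opucS mulrDr -scalerAr ih paraSS riccatiS.
rewrite scalerBr scalerA divfK// -!mul_polyC !polyCB !polyC_natr.
by ring.
Qed.

End para.

(* [1 + a] is the attracting fixed point of the recursion. *)
Section riccati.
Context {R : realType}.
Implicit Types a : R.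

(** The map e -> 2 - (1 - a^2) / e is increasing for e > 0, fixes 1 + a and stays below 2. *)
Lemma riccati_bound a n : 0 < a -> a < 1 ->
  1 + a <= riccati (1 - a ^+ 2) n <= 2.
Proof.
move=> a0 a1; have A0 : 0 < 1 - a ^+ 2 by rewrite subr_gt0 expr_lt1// ltW.
elim: n => [|n /andP[ih1 ih2]]; first by rewrite /= lexx andbT; lra.
have e0 : 0 < riccati (1 - a ^+ 2) n by lra.
rewrite riccatiS gerBl divr_ge0 ?(ltW e0) ?(ltW A0)// andbT lerBrDl -lerBrDr.
by rewrite ler_pdivrMr//; nra.
Qed.

Lemma riccati_lt2 a n : 0 < a -> a < 1 -> riccati (1 - a ^+ 2) n.+1 < 2.
Proof.
move=> a0 a1; have /andP[e1 e2] := riccati_bound n a0 a1.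
by rewrite riccatiS gtrBl divr_gt0 ?subr_gt0 ?expr_lt1 ?(ltW a0)//; lra.
Qed.

Lemma riccati_contract a n : 0 < a -> a < 1 ->
  riccati (1 - a ^+ 2) n.+1 - (1 + a) <=
  (1 - a) / (1 + a) * (riccati (1 - a ^+ 2) n - (1 + a)).
Proof.
move=> a0 a1; have /andP[] := riccati_bound n a0 a1.
rewrite riccatiS; move: (riccati _ n) => e e1 e2.
have e0 : 0 < e by lra.
have -> : 2 - (1 - a ^+ 2) / e - (1 + a) = (1 - a) / e * (e - (1 + a)).
  by field; rewrite gt_eqF.
rewrite ler_wpM2r ?subr_ge0// ler_wpM2l ?subr_ge0 ?(ltW a1)// lef_pV2 ?posrE//.
by lra.
Qed.

Lemma riccati_sum a n : 0 < a -> a < 1 ->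
  \sum_(0 <= k < n) (riccati (1 - a ^+ 2) k - (1 + a)) <= 1 / a.
Proof.
move=> a0 a1; set e := riccati (1 - a ^+ 2).
(* The contraction factor is 1 - 2 a / (1 + a), so the distances to the fixed point, multiplied by 2
   a / (1 + a), are dominated by a telescoping sum; the first distance is 2 - (1 + a) = 1 - a. *)
have h m : \sum_(0 <= k < m) (e k - (1 + a)) * (2 * a / (1 + a))
    <= (1 - a) - (e m - (1 + a)).
  elim: m => [|m ih]; first by rewrite big_nil /=; lra.
  rewrite big_nat_recr//=.
  have := riccati_contract m a0 a1; rewrite -/e.
  have -> : (1 - a) / (1 + a) = 1 - 2 * a / (1 + a) by field; lra.
  by lra.
have := h n; rewrite -mulr_suml -ler_pdivlMr; last by apply: divr_gt0; lra.
move=> /le_trans; apply.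
have := riccati_bound n a0 a1; rewrite -/e => /andP[e1 e2].
rewrite ler_pdivrMr; last by apply: divr_gt0; lra.
have -> : 1 / a * (2 * a / (1 + a)) = 2 / (1 + a).
  by field; lra.
rewrite ler_pdivlMr; last by lra.
by nra.
Qed.

End riccati.

(** * The semicircle law in the angular variable *)

Lemma is_derive_horner (R : realType) (p : {poly R}) (x : R) :
  is_derive x 1 (horner p) p^`().[x].
Proof.
apply: DeriveDef; first exact: derivable_horner.
by rewrite -derive1E -derivE.
Qed.

(** Although the square root is not differentiable at 0, y sqrt y is differentiable everywhere,
    being 0 for y < 0 and having difference quotient sqrt h at 0. The fundamental theorem thus
    applies on [0, 2 pi] without splitting at the ends of the arc. *)
Lemma is_derive_mul_sqrt (R : realType) (x : R) :
  is_derive x 1 (fun y => y * Num.sqrt y) (3 / 2 * Num.sqrt x).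
Proof.
have [x0|x0|->] := ltgtP x 0.
- rewrite ler0_sqrtr ?ltW// mulr0.
  apply: (near_eq_is_derive (f := cst 0)).
    near=> y; rewrite ler0_sqrtr ?mulr0// ltW//; near: y.
    exact: lt_nbhsl.
- have q0 : Num.sqrt x != 0 by rewrite gt_eqF// sqrtr_gt0.
  have ds := is_derive1_sqrt x0.
  apply: trigger_derive.
  rewrite /GRing.scale/= !mulr1 -{1}(sqr_sqrtr (ltW x0)).
  by field.
- rewrite sqrtr0 mulr0.
  have h : (fun h : R => h^-1 *: ((h + 0) * Num.sqrt (h + 0) - 0 * Num.sqrt 0))
     @ 0^' --> (0 : R).
    apply: (@cvg_trans _ (Num.sqrt h @[h --> 0^'])).
      apply: near_eq_cvg; near=> h.
      have h0 : h != 0 by near: h; exact: nbhs_dnbhs_neq.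
      by rewrite addr0 mul0r subr0 /GRing.scale/= mulKf.
    have := @sqrt_continuous R 0; rewrite /continuous_at sqrtr0 => c.
    exact: cvg_within_filter c.
  have h' : (fun h : R => h^-1 *: (((fun y : R => y * Num.sqrt y) \o shift 0) (h *: 1)
     - 0 * Num.sqrt 0)) @ 0^' --> (0 : R).
    apply: cvg_trans h; apply: near_eq_cvg; near=> h.
    by rewrite /= /GRing.scale/= mulr1.
  split; last exact: cvg_lim h'.
  by apply/cvg_ex; exists 0.
Unshelve. all: by end_near. Qed.

Lemma Rintegral_FTC (R : realType) (F f : R -> R) (a b : R) : a < b ->
  (forall x : R, is_derive x 1 F (f x)) -> continuous f ->
  \int[lebesgue_measure]_(x in `[a, b]) f x = F b - F a.
Proof.
move=> ab dF cf.
have cF : continuous F.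
  move=> x; apply/differentiable_continuous/derivable1_diffP.
  by have [] := dF x.
rewrite /Rintegral (@continuous_FTC2 _ _ F)//.
- by apply: continuous_subspaceT.
- split.
  + by move=> x _; have [] := dF x.
  + by apply: cvg_at_right_filter; exact: cF.
  + by apply: cvg_at_left_filter; exact: cF.
- by move=> x _; rewrite derive1E; have [_ ->] := dF x.
Qed.

Section semicircle.
Context {R : realType} (A : R).
Implicit Types (f h : R -> R) (t : R).

Let y t := A - cos (t / 2) ^+ 2.

Definition xvar t : R := 2 * cos (t / 2).

(* The semicircle density in the variable [t]: the factor [sin (t / 2)] is the
   Jacobian of [cos (t / 2)], and the square root vanishes off the arc. *)
Definition semicircle t : R := sin (t / 2) * Num.sqrt (y t).

Let continuous_half (k : R -> R) : continuous k -> continuous (fun t => k (t / 2)).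
Proof.
move=> ck t; apply: (@continuous_comp _ _ _ (fun t => t / 2) k); last exact: ck.
by apply: cvgMl; exact: cvg_id.
Qed.

Let continuous_y : continuous y.
Proof.
move=> t; apply: cvgB; first exact: cvg_cst.
by apply: cvgM; exact: (continuous_half (@continuous_cos R)).
Qed.

Lemma continuous_semicircle : continuous semicircle.
Proof.
move=> t; apply: cvgM; first exact: (continuous_half (@continuous_sin R)).
by apply: (@continuous_comp _ _ _ y Num.sqrt); [exact: continuous_y|exact: sqrt_continuous].
Qed.

Lemma continuous_xvar : continuous xvar.
Proof.
by move=> t; apply: cvgMr; exact: (continuous_half (@continuous_cos R)).
Qed.

(** In the variable x = [xvar t] the function is p (A - x^2 / 4)^(3/2), and dx/dt = - sin (t /
    2). *)
Lemma is_derive_antideriv (p : {poly R}) t :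
  is_derive t 1 (fun t => p.[xvar t] * (y t * Num.sqrt (y t)))
   (- 4^-1 * ((((4 * A)%:P - 'X ^+ 2) * p^`() - 3 *: ('X * p)).[xvar t] * semicircle t)).
Proof.
have dh : is_derive t 1 (fun t : R => t / 2) (2^-1).
  have d := @is_deriveM R R id (cst 2^-1) t 1 _ _ (is_derive_id _ _) (is_derive_cst _ _ _).
  by apply: trigger_derive d _; rewrite /GRing.scale/=; ring.
have dc : is_derive t 1 (fun t : R => cos (t / 2)) (- sin (t / 2) / 2).
  exact: (@is_derive1_comp R cos (fun t : R => t / 2) t _ _ (is_derive_cos _) dh).
have dx : is_derive t 1 xvar (- sin (t / 2)).
  have d := @is_deriveM R R (cst 2) _ t 1 _ _ (is_derive_cst _ _ _) dc.
  by apply: trigger_derive d _; rewrite /GRing.scale/=; field.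
have dy : is_derive t 1 y (cos (t / 2) * sin (t / 2)).
  have d := @is_deriveB R R R (cst A) _ t 1 _ _ (is_derive_cst _ _ _)
    (@is_deriveM R R _ _ t 1 _ _ dc dc).
  by apply: trigger_derive d _; rewrite /GRing.scale/=; field.
have dp : is_derive t 1 (fun t => p.[xvar t]) (p^`().[xvar t] * - sin (t / 2)).
  exact: (@is_derive1_comp R (horner p) xvar t _ _ (is_derive_horner p _) dx).
have dyy : is_derive t 1 (fun t => y t * Num.sqrt (y t))
   (3 / 2 * Num.sqrt (y t) * (cos (t / 2) * sin (t / 2))).
  exact: (@is_derive1_comp R (fun y => y * Num.sqrt y) y t _ _
    (is_derive_mul_sqrt _) dy).
have d := @is_deriveM R R _ _ t 1 _ _ dp dyy.
apply: trigger_derive d _.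
rewrite /GRing.scale/= hornerD hornerN hornerZ !hornerM hornerX hornerD hornerN.
rewrite hornerC hornerXn /semicircle /y /xvar.
by field.
Qed.

Definition semicircle_int h : R :=
  \int[lebesgue_measure]_(t in `[0, 2 * pi]) (h t * semicircle t).

Lemma semicircle_integrable h : continuous h ->
  lebesgue_measure.-integrable `[0, 2 * pi] (EFin \o (fun t => h t * semicircle t)).
Proof.
move=> ch; apply: continuous_compact_integrable; first exact: segment_compact.
apply: continuous_subspaceT => t; apply: cvgM; first exact: ch.
exact: continuous_semicircle.
Qed.

Lemma semicircle_intD f h : continuous f -> continuous h ->
  semicircle_int (fun t => f t + h t) = semicircle_int f + semicircle_int h.
Proof.
move=> cf ch; rewrite /semicircle_int -RintegralD//; last 2 first.
- exact: semicircle_integrable.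
- exact: semicircle_integrable.
by apply: eq_Rintegral => t _; rewrite mulrDl.
Qed.

Lemma semicircle_intZ (c : R) h : continuous h ->
  semicircle_int (fun t => c * h t) = c * semicircle_int h.
Proof.
move=> ch; rewrite /semicircle_int -RintegralZl//; last exact: semicircle_integrable.
by apply: eq_Rintegral => t _; rewrite mulrA.
Qed.

Lemma continuous_horner_xvar (p : {poly R}) : continuous (fun t => p.[xvar t]).
Proof.
move=> t; apply: (@continuous_comp _ _ _ xvar (horner p)).
  exact: continuous_xvar.
exact: continuous_horner.
Qed.

Hypothesis A01 : 0 < A < 1.

(* The Pearson identity of the semicircle law: the integrand is the derivative
   of [p (A - cos^2 (t / 2))^(3/2)], which vanishes at [0] and [2 pi]. *)
Lemma semicircle_pearson (p : {poly R}) : semicircle_int (fun t =>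
  (((4 * A)%:P - 'X ^+ 2) * p^`() - 3 *: ('X * p)).[xvar t]) = 0.
Proof.
set q := _ - _; pose F t := p.[xvar t] * (y t * Num.sqrt (y t)).
have [_ A1] := andP A01.
(* Here A < 1 makes the radicand negative, where the square root takes the value 0. *)
have yneg t : cos (t / 2) ^+ 2 = 1 -> Num.sqrt (y t) = 0.
  by move=> h; rewrite ler0_sqrtr// /y h subr_le0 ltW.
have := @Rintegral_FTC R F (fun t => - 4^-1 * (q.[xvar t] * semicircle t)) 0 (2 * pi).
rewrite mulr_gt0 ?pi_gt0// => /(_ isT (is_derive_antideriv p)) I.
have {I} : \int[lebesgue_measure]_(t in `[0, 2 * pi])
    (- 4^-1 * (q.[xvar t] * semicircle t)) = F (2 * pi) - F 0.
  apply: I => t; apply: cvgMr; apply: cvgM; last exact: continuous_semicircle.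
  exact: continuous_horner_xvar.
rewrite RintegralZl//; last first.
  by apply: semicircle_integrable; exact: continuous_horner_xvar.
rewrite /F !yneg.
- rewrite !mulr0 subrr => /eqP; rewrite mulf_eq0 oppr_eq0 invr_eq0 pnatr_eq0/=.
  by move/eqP.
- by rewrite mul0r cos0 expr1n.
- by rewrite mulrC mulKf ?pnatr_eq0// cospi sqrrN expr1n.
Qed.

Let J n m := semicircle_int (fun t => (cheb A n).[xvar t] * cos (m%:R * (t / 2))).

Lemma continuous_cosm m : continuous (fun t => cos (m%:R * (t / 2)) : R).
Proof.
move=> t; apply: (@continuous_comp _ _ _ (fun t => m%:R * (t / 2)) cos).
  by apply: cvgMr; apply: cvgMl; exact: cvg_id.
exact: continuous_cos.
Qed.

Lemma continuous_cheb_cos n m :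
  continuous (fun t => (cheb A n).[xvar t] * cos (m%:R * (t / 2))).
Proof.
move=> t; apply: cvgM; first exact: continuous_horner_xvar.
exact: continuous_cosm.
Qed.

Let continuous_J n m :
  continuous (fun t => (cheb A n).[xvar t] * cos (m%:R * (t / 2))).
Proof. exact: continuous_cheb_cos. Qed.

Let J0E n : J n 0 = semicircle_int (fun t => (cheb A n).[xvar t]).
Proof.
by rewrite /J; congr semicircle_int; apply/funext => t; rewrite mul0r cos0 mulr1.
Qed.

(** The Pearson identity for [cheb A m] combines [cheb A m.+1] and [cheb A m.-1] with coefficients -
    (m + 3) and (m - 1) A, so vanishing passes up by two indices. For m = 0 and m = 1 only the first
    term is present, hence d = 0. *)
Let JS0 n : J n.+1 0 = 0.
Proof.
have L n1 n2 (c d : R) : c != 0 ->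
    d * semicircle_int (fun t => (cheb A n2.-1).[xvar t]) = 0 ->
    (forall t, (((4 * A)%:P - 'X ^+ 2) * (cheb A n1)^`() - 3 *: ('X * cheb A n1)).[xvar t]
      = c * (cheb A n2.+1).[xvar t] + d * (cheb A n2.-1).[xvar t]) ->
    semicircle_int (fun t => (cheb A n2.+1).[xvar t]) = 0.
  move=> c0 d0 h; apply: (mulfI c0); rewrite mulr0 -[LHS]addr0 -[X in _ + X]d0.
  rewrite -!semicircle_intZ; try exact: continuous_horner_xvar.
  rewrite -semicircle_intD; try
    by move=> t; apply: cvgMr; exact: continuous_horner_xvar.
  rewrite -[RHS](semicircle_pearson (cheb A n1)).
  by congr semicircle_int; apply/funext => t; rewrite h.
rewrite J0E; elim/nat_ind2: n => [||n ih _].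
- apply: (L 0%N 0%N (-3) 0) => [||t]; rewrite ?mul0r ?oppr_eq0 ?pnatr_eq0//.
  by rewrite cheb_deriv !hornerE/=; ring.
- apply: (L 1%N 1%N (-4) 0) => [||t]; rewrite ?mul0r ?oppr_eq0 ?pnatr_eq0//.
  by rewrite cheb_deriv /= !hornerE/=; ring.
- apply: (L n.+2 n.+2 (- n.+4.+1%:R) (n.+1%:R * A)) => [||t].
  + by rewrite oppr_eq0 pnatr_eq0.
  + by rewrite ih mulr0.
  rewrite cheb_deriv (chebSS A n.+1) -[n.+2.-1]/(n.+1).
  move: (cheb A n.+1) (cheb A n.+2) => p1 p2.
  rewrite !(hornerD, hornerN, hornerZ, hornerM) hornerX.
  by ring.
Qed.

Let xvar_cheb n t :
  xvar t * (cheb A n.+1).[xvar t] = (cheb A n.+2).[xvar t] + A * (cheb A n).[xvar t].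
Proof. by rewrite chebSS !hornerE subrK. Qed.

Let J1 n : 2 * J n.+1 1 = J n.+2 0 + A * J n 0.
Proof.
rewrite /J -!semicircle_intZ// -semicircle_intD//; last first.
  by move=> t; apply: cvgMr; exact: continuous_cheb_cos.
congr semicircle_int; apply/funext => t.
rewrite !mul0r cos0 !mulr1 -xvar_cheb mul1r.
by rewrite mulrCA mulrC.
Qed.

(** Multiplying by x = 2 cos (t / 2) acts on the Chebyshev factor by its three-term recurrence and
    on the cosine by the product-to-sum formula; the two results are equated. *)
Let JSS n m : J n.+1 m.+2 = J n.+2 m.+1 + A * J n m.+1 - J n.+1 m.
Proof.
apply/eqP; rewrite eq_sym subr_eq; apply/eqP.
rewrite /J -!semicircle_intZ// -!semicircle_intD//; last first.
  by move=> t; apply: cvgMr; exact: continuous_cheb_cos.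
congr semicircle_int; apply/funext => t.
rewrite [A * _]mulrA -mulrDl -xvar_cheb -mulrDr mulrAC [LHS]mulrC.
congr (_ * _).
have -> : m.+2%:R * (t / 2) = m.+1%:R * (t / 2) + t / 2.
  by rewrite -[m.+2]addn1 natrD mulrDl mul1r.
have -> : m%:R * (t / 2) = m.+1%:R * (t / 2) - t / 2.
  by rewrite -[m.+1]addn1 natrD mulrDl mul1r addrK.
by rewrite cosD cosB /xvar; ring.
Qed.

(** This is the orthogonality of the Chebyshev polynomials for the semicircle law: cos (m t / 2) is
    a polynomial of degree m in [xvar t]. *)
Lemma semicircle_int_cheb_cos n m : (m < n)%N -> semicircle_int (fun t =>
  (cheb A n).[xvar t] * cos (m%:R * (t / 2))) = 0.
Proof.
rewrite -/(J n m); elim/nat_ind2: m n => [||m ih ih1] [//|n].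
- by rewrite JS0.
- case: n => // n _; apply/eqP; rewrite -[_ == 0]/(J n.+2 1 == 0).
  have /eqP := J1 n.+1; rewrite !JS0 mulr0 addr0 mulf_eq0 pnatr_eq0/=.
  by [].
- by move=> mn; rewrite JSS ih1 ?ih1 ?ih ?mulr0 ?addr0 ?subr0//; lia.
Qed.

(** Each step of the recursion multiplies by A, its other two terms vanishing. The factor 1/2 enters
    with the first cosine and is absent at index 0, so the formula starts at n + 1. *)
Lemma semicircle_int_cheb_cos_diag n : semicircle_int (fun t =>
  (cheb A n.+1).[xvar t] * cos (n.+1%:R * (t / 2))) =
  A ^+ n.+1 / 2 * semicircle_int (fun=> 1).
Proof.
rewrite -/(J n.+1 n.+1); elim: n => [|n ih].
  have := J1 0; rewrite JS0 add0r J0E; under eq_fun do rewrite hornerC.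
  move=> h; apply: (@mulfI _ 2); first by rewrite pnatr_eq0.
  by rewrite h; field.
have J31 : J n.+3 n.+1 = 0 by exact: semicircle_int_cheb_cos.
have J20 : J n.+2 n = 0 by exact: semicircle_int_cheb_cos.
by rewrite JSS ih J31 J20 add0r subr0 mulrA mulrA -exprS.
Qed.

End semicircle.

(** * Transport of integrals through a map and a density *)

Section density.
Context d1 d2 (X : measurableType d1) (Y : measurableType d2) (R : realType).
Variables (mu : {measure set X -> \bar R}) (nu : {measure set Y -> \bar R}).
Variables (phi : X -> Y) (D : set X) (w : X -> R).
Hypotheses (mphi : measurable_fun setT phi) (mD : measurable D).
Hypotheses (mw : measurable_fun D w) (w0 : forall x, D x -> 0 <= w x).
Hypothesis nuE : forall B, measurable B ->
  (nu B = \int[mu]_(x in D `&` phi @^-1` B) (w x)%:E)%E.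

Import HBNNSimple.

Let density_nnsfun (h : {nnsfun Y >-> R}) :
  (\int[nu]_y (h y)%:E = \int[mu]_(x in D) ((h (phi x))%:E * (w x)%:E))%E.
Proof.
rewrite integralT_nnsfun sintegralE.
under [RHS]eq_integral => x xD.
  rewrite fimfunE -fsumEFin// ge0_mule_fsuml; last first.
    by move=> r; rewrite EFinM nnfun_muleindic_ge0.
  over.
rewrite ge0_integral_fsum//; last 2 first.
- move=> r; apply: emeasurable_funM; apply/measurable_EFinP => //.
  apply: (@measurable_comp _ _ _ _ _ _ setT (fun y => r * \1_(h @^-1` [set r]) y)) => //.
    exact: measurable_funM.
  exact: measurable_funTS.
- move=> r x Dx; apply: mule_ge0; last by rewrite lee_fin w0.
  by rewrite EFinM nnfun_muleindic_ge0.
apply: eq_fsbigr => r /[!inE] -[y _ hy].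
have mB : measurable (h @^-1` [set r]) by exact: measurable_sfunP.
rewrite nuE// integral_mkcondr.
rewrite -ge0_integralZl//; last 3 first.
- apply/measurable_restrict => //; first by rewrite -[X in measurable X]setTI; exact: mphi.
  by apply: measurable_funS mD _ _ => //; exact/measurable_EFinP.
- by move=> x Dx; rewrite patchE; case: ifP => // _; rewrite lee_fin w0.
- by rewrite lee_fin -hy.
apply: eq_integral => x _; rewrite patchE indicE.
rewrite (_ : (x \in phi @^-1` _) = (phi x \in h @^-1` [set r])); last first.
  by apply/idP/idP; rewrite !inE.
by case: ifP => _; rewrite ?mulr1 ?mulr0 ?mul0e ?mule0.
Qed.

Lemma ge0_integral_density (f : Y -> \bar R) :
  measurable_fun setT f -> (forall y, 0 <= f y)%E ->
  (\int[nu]_y f y = \int[mu]_(x in D) (f (phi x) * (w x)%:E))%E.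
Proof.
move=> mf f0; pose h := nnsfun_approx measurableT mf.
have hf y : ((h n y)%:E @[n --> \oo] --> f y)%E by exact: cvg_nnsfun_approx.
have hm y : {homo (fun n => (h n y)%:E) : m n / (m <= n)%N >-> (m <= n)%E}.
  by move=> m n mn; rewrite lee_fin; exact/lefP/nd_nnsfun_approx.
transitivity (lim (\int[nu]_y (h n y)%:E @[n --> \oo]))%E.
  rewrite -monotone_convergence//=.
  - by apply: eq_integral => y _; apply/esym/cvg_lim => //; exact: hf.
  - by move=> n; exact/measurable_EFinP.
  - by move=> n y _; rewrite lee_fin.
transitivity (lim (\int[mu]_(x in D) ((h n (phi x))%:E * (w x)%:E) @[n --> \oo]))%E.
  by apply: congr_lim; apply/funext => n; exact: density_nnsfun.
rewrite -monotone_convergence//=.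
- apply: eq_integral => x _; apply/cvg_lim => //.
  by apply: cvgeZr => //; exact: hf.
- move=> n; apply: emeasurable_funM; apply/measurable_EFinP => //.
  by apply: measurable_funTS; exact: measurableT_comp.
- by move=> n x Dx; rewrite mule_ge0// lee_fin// w0.
- move=> x Dx m n mn; rewrite lee_wpmul2r ?lee_fin ?w0//.
  by have := hm (phi x) _ _ mn; rewrite lee_fin.
Qed.

(** Positive and negative parts are transported separately; taking them commutes with multiplication
    by the nonnegative weight. *)
Lemma Rintegral_density (f : Y -> R) : measurable_fun setT f ->
  \int[nu]_y f y = \int[mu]_(x in D) (f (phi x) * w x).
Proof.
move=> mf; rewrite /Rintegral integralE [in RHS]integralE.
have mf' : measurable_fun setT (EFin \o f) by exact/measurable_EFinP.
have rew (k : R) (x : X) : D x -> (maxe k%:E 0 * (w x)%:E = maxe (k * w x)%:E 0)%E.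
  by move=> Dx; rewrite -!EFin_max -EFinM maxr_pMl ?w0// mul0r.
congr (fine (_ - _)%E); rewrite ge0_integral_density.
- by apply: eq_integral => x /[!inE] Dx; rewrite !funeposE/= rew.
- exact: measurable_funepos.
- by move=> y; exact: funepos_ge0.
- apply: eq_integral => x /[!inE] Dx; rewrite !funenegE/= rew//.
  by rewrite mulNr.
- exact: measurable_funeneg.
- by move=> y; exact: funeneg_ge0.
Qed.

End density.

(** * The Gross-Witten measure *)

Section gross_witten.
Context {R : realType} (g : R).
Hypothesis g1 : 1 < g.
Let A := g^-1.
Let D : set R := `[0, 2 * pi].

Let g0 : 0 < g. Proof. exact: lt_trans g1. Qed.

Let A01 : 0 < A < 1. Proof. by rewrite invr_gt0 g0 invf_lt1. Qed.

Let semicircle_ge0 t : D t -> 0 <= semicircle A t.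
Proof.
rewrite /D/= in_itv/= => /andP[t0 t2]; rewrite mulr_ge0 ?sqrtr_ge0//.
by apply: sin_ge0_pi; rewrite divr_ge0//= ler_pdivrMr// mulrC.
Qed.

(** The indicator is absorbed by the square root: off the arc, |pi - t| > [theta_g g], so cos^2 (t /
    2) = sin^2 (|pi - t| / 2) exceeds 1 / g and the radicand is negative. *)
Lemma gross_witten_densityE t : 0 <= t <= 2 * pi ->
  gross_witten_density g t = g / pi * semicircle g^-1 t.
Proof.
move=> /andP[t0 t2]; rewrite /gross_witten_density /semicircle.
have [/andP[th0 thpi] sth] := theta_gP g1.
have cth : cos (theta_g g / 2) ^+ 2 = 1 - A by rewrite cos2sin2 sth.
have -> : sin (t / 2) ^+ 2 - cos (theta_g g / 2) ^+ 2 = A - cos (t / 2) ^+ 2.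
  by rewrite cth sin2cos2; ring.
rewrite indicE; have [|tn] := boolP (_ \in _); first by rewrite mulr1 mulrA.
rewrite mulr0.
suff -> : Num.sqrt (A - cos (t / 2) ^+ 2) = 0 by rewrite !mulr0.
apply: ler0_sqrtr; rewrite subr_le0 -[A]/(g^-1) -sth.
have -> : cos (t / 2) = sin ((pi - t) / 2).
  by rewrite mulrBl sinB sin_pihalf cos_pihalf mul1r mul0r subr0.
have : theta_g g < `|pi - t|.
  rewrite ltNge; apply: contra tn => h; rewrite inE/= in_itv/=.
  by move: h; rewrite ler_norml => /andP[? ?]; apply/andP; split; lra.
have h2 : `|pi - t| <= pi by rewrite ler_norml; apply/andP; split; lra.
have -> : sin ((pi - t) / 2) ^+ 2 = sin (`|pi - t| / 2) ^+ 2.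
  have [/ger0_norm->//|/ltW/ler0_norm->] := leP 0 (pi - t).
  by rewrite [in RHS]mulNr sinN sqrrN.
move=> h1; have pi0 := pi_gt0 R.
rewrite ler_sqr ?nnegrE; try by apply: sin_ge0_pi; apply/andP; split; lra.
by apply/ltW; rewrite ltr_sin ?in_itv/=; try (apply/andP; split); lra.
Qed.

Let measurable_expi : measurable_fun setT (@expi R).
Proof.
apply: measurable_fun_pair; apply: continuous_measurable_fun.
- exact: continuous_cos.
- exact: continuous_sin.
Qed.

Let gross_wittenE (B : set (R * R)) :
  (gross_witten g B = \int[lebesgue_measure]_(t in D `&` @expi R @^-1` B)
     (g / pi * semicircle A t)%:E)%E.
Proof.
rewrite /gross_witten; apply: eq_integral => t /[!inE] -[Dt _].
by rewrite gross_witten_densityE.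
Qed.

Let continuous_cs : continuous (fun t => g / pi * semicircle A t).
Proof. by move=> t; apply: cvgMr; exact: continuous_semicircle. Qed.

Let integrable_cs :
  lebesgue_measure.-integrable D (EFin \o (fun t => g / pi * semicircle A t)).
Proof.
apply: continuous_compact_integrable; first exact: segment_compact.
exact: continuous_subspaceT.
Qed.

Lemma Rintegral_gross_witten (f : R * R -> R) : measurable_fun setT f ->
  \int[gross_witten g]_z f z =
  semicircle_int g^-1 (fun t => g / pi * f (expi t)).
Proof.
move=> mf; rewrite (@Rintegral_density _ _ _ _ _ lebesgue_measure (gross_witten g)
  (@expi R) D (fun t => g / pi * semicircle A t))//.
- by apply: eq_Rintegral => t _; rewrite mulrA [f _ * _]mulrC.
- exact: measurable_itv.
- exact: measurable_funTS (continuous_measurable_fun continuous_cs).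
- move=> t Dt; rewrite mulr_ge0 ?semicircle_ge0//.
  by rewrite divr_ge0 ?pi_ge0// ltW.
- by move=> B _; exact: gross_wittenE.
Qed.

Lemma gross_witten_lty : (gross_witten g setT < +oo)%E.
Proof.
rewrite gross_wittenE// preimage_setT setIT.
have /integrableP[_] := integrable_cs; apply: le_lt_trans.
rewrite le_eqVlt; apply/orP; left; apply/eqP; apply: eq_integral => t /[!inE] Dt.
rewrite gee0_abs// lee_fin mulr_ge0 ?semicircle_ge0//.
by rewrite divr_ge0 ?pi_ge0// ltW.
Qed.

Lemma gross_witten_circle : gross_witten g (~` @unit_circle R) = 0%E.
Proof.
rewrite /gross_witten (_ : _ `&` _ = set0) ?integral_set0//.
rewrite -subset0 => t [_]; apply.
by rewrite /unit_circle/= cos2Dsin2 sqrtr1.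
Qed.

Let semicircle_pi : 0 < semicircle A pi.
Proof.
have [A0 _] := andP A01.
by rewrite /semicircle sin_pihalf cos_pihalf mul1r expr0n/= subr0 sqrtr_gt0.
Qed.

(** By continuity the density stays above half its value at t on an interval [B] that [expi] sends
    into U, so U has mass at least k / 2 times the length of [B]. *)
Let mem_support t : 0 < t < 2 * pi -> 0 < semicircle A t ->
  msupport (gross_witten g) (expi t).
Proof.
move=> /andP[t0 t2] st U oU Ut.
have c0 : 0 < g / pi by rewrite divr_gt0 ?pi_gt0.
pose k := g / pi * semicircle A t.
have k0 : 0 < k by rewrite mulr_gt0.
have cexpi : continuous (@expi R).
  by move=> s; exact: (cvg_pair (@continuous_cos R s) (@continuous_sin R s)).
have : \forall s \near t, [/\ 0 < s, s < 2 * pi, U (expi s) &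
    k / 2 < g / pi * semicircle A s].
  near=> s; split; near: s.
  - exact: lt_nbhsr.
  - exact: lt_nbhsl.
  - by apply: (cexpi t); exact: open_nbhs_nbhs.
  - have /cvgr_gt := @continuous_cs t; apply.
    by rewrite -/k ltr_pdivrMr// ltr_pMr// ltr1n.
move=> /nbhs_ballP[e /= e0 eU].
pose B : set R := `[t - e / 2, t + e / 2]%classic.
have BU s : B s -> [/\ 0 < s, s < 2 * pi, U (expi s) &
    k / 2 < g / pi * semicircle A s].
  rewrite /B/= in_itv/= => /andP[s1 s2]; apply: eU.
  by rewrite /ball/= ltr_distl; apply/andP; split; lra.
rewrite gross_wittenE.
apply: (@lt_le_trans _ _ (\int[lebesgue_measure]_(s in B) (k / 2)%:E)%E).
  rewrite integral_cst//=; last exact: measurable_itv.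
  rewrite /B lebesgue_measure_itv/= lte_fin.
  rewrite ifT; last by lra.
  by rewrite -EFinB -EFinM lte_fin mulr_gt0 ?divr_gt0//; lra.
have mk : measurable_fun setT (fun s => (g / pi * semicircle A s)%:E).
  by apply/measurable_EFinP; exact: continuous_measurable_fun.
have mDU : measurable (D `&` @expi R @^-1` U).
  apply: measurableI; first exact: measurable_itv.
  by apply: open_measurable; apply: open_comp => // s _; exact: cexpi.
have BDU : B `<=` D `&` @expi R @^-1` U.
  move=> s /BU[s1 s2 Us _]; split=> //.
  by rewrite /D/= in_itv/=; apply/andP; split; exact: ltW.
apply: (@le_trans _ _ (\int[lebesgue_measure]_(s in B) (g / pi * semicircle A s)%:E)%E).
  apply: ge0_le_integral => //; first exact: measurable_itv.
  - by move=> s _; rewrite lee_fin divr_ge0// ltW.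
  - exact: measurable_funTS.
  - by move=> s /BU[_ _ _ /ltW]; rewrite lee_fin.
apply: ge0_subset_integral => //; first exact: measurable_itv.
  exact: measurable_funTS.
move=> s [/semicircle_ge0 ? _]; rewrite lee_fin mulr_ge0//; exact: ltW.
Unshelve. all: by end_near. Qed.

Lemma gross_witten_support : infinite_set (msupport (gross_witten g)).
Proof.
have pi0 := pi_gt0 R.
have : \forall s \near (pi : R), 0 < s /\ 0 < semicircle A s.
  near=> s; split; near: s; first exact: lt_nbhsr.
  have /cvgr_gt := @continuous_semicircle R A pi; apply.
  exact: semicircle_pi.
move=> /nbhs_ballP[e /= e0 eP].
(* The bound by e keeps the density positive on [B]; the bound by pi keeps [B] inside [0, pi], where
   the cosine, hence [expi], is injective. *)
pose d := Num.min e pi.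
pose B : set R := `]pi - d, pi[%classic.
have BP s : B s -> [/\ 0 < s, s < pi & 0 < semicircle A s].
  rewrite /B/= in_itv/= => /andP[s1 s2].
  have de : d <= e by rewrite ge_min lexx.
  have /eP[s0 ss] // : ball (pi : R) e s.
  by rewrite /ball/= ltr_distl; apply/andP; split; lra.
have infB : infinite_set B.
  move=> /finite_set_countable /countable_lebesgue_measure0.
  rewrite /B lebesgue_measure_itv/= lte_fin ifT; last by rewrite gtrBl /d lt_min e0.
  rewrite -EFinB => -[]; rewrite opprB addrC subrK => dE.
  have d0 : 0 < d by rewrite lt_min e0 pi0.
  by move: d0; rewrite dE ltxx.
move=> fsupp; apply: infB.
have injB : {in B &, injective (@expi R)}.
  move=> s s' /[!inE] /BP[s0 spi _] /BP[s'0 s'pi _] [cs _].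
  by apply: cos_inj cs; rewrite in_itv/=; apply/andP; split; exact: ltW.
rewrite -(eq_finite_set (inj_card_eq injB)).
apply: sub_finite_set fsupp => _ [s /BP[s0 spi ss] <-].
by apply: mem_support => //; apply/andP; split=> //; lra.
Unshelve. all: by end_near. Qed.

End gross_witten.

(** * From the semicircle law to orthogonality on the circle *)

Lemma toC_expiD (R : realType) (s t : R) :
  toC (expi (s + t)) = toC (expi s) * toC (expi t).
Proof.
by rewrite /toC /expi/= cosD sinD; apply/eqP; rewrite eq_complex/= addrC eqxx addrC eqxx.
Qed.

(** With e_k = e^(i k t / 2), one has e_2 + 1 = [xvar t] e_1, so the factor e_n turns the recurrence
    of [cheb] into that of [para]. *)
Lemma para_expi (R : realType) (A : R) n t :
  (para A%:C n).[toC (expi t)] =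
  ((cheb A n).[xvar t])%:C * toC (expi (n%:R * (t / 2))).
Proof.
pose e (k : nat) := toC (expi (k%:R * (t / 2))).
have eS k : e k.+1 = e 1%N * e k.
  by rewrite /e -toC_expiD -mulrDl -natrD add1n.
have -> : toC (expi t) = e 2%N by rewrite /e; congr (toC (expi _)); field.
have e21 : e 2%N + 1 = (xvar t)%:C * e 1%N.
  rewrite /e (_ : 2 * (t / 2) = t / 2 + t / 2); last by field.
  rewrite mul1r /toC /expi /xvar/= cosD sinD -expr2 -expr2 sin2cos2.
  by apply/eqP; rewrite eq_complex/=; apply/andP; split; apply/eqP; ring.
rewrite -/(e n); elim/nat_ind2: n => [||n ih ih1].
- by rewrite !hornerE /e mul0r /toC /expi/= cos0 sin0.
- by rewrite /= hornerD !hornerE e21.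
- rewrite paraSS chebSS; move: ih ih1.
  move: (cheb A n) (cheb A n.+1) (para _ n) (para _ n.+1) => p p1 r r1 ih ih1.
  rewrite !(hornerD, hornerN, hornerZ, hornerM, hornerX) hornerC ih ih1 e21 (eS n.+1) (eS n).
  by rewrite (eS 1%N) rmorphB !rmorphM/=; ring.
Qed.

Lemma horner_conj_para (R : realType) (A : R) n (z : R[i]) :
  (para A%:C n).[z^*%C] = ((para A%:C n).[z])^*%C.
Proof.
elim/nat_ind2: n => [||n ih ih1].
- by rewrite !hornerE rmorph1.
- by rewrite /= !hornerE rmorphD rmorph1.
- rewrite paraSS; move: ih ih1; move: (para _ n) (para _ n.+1) => r r1 ih ih1.
  rewrite !(hornerD, hornerN, hornerZ, hornerM, hornerX) !hornerC ih ih1.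
  by rewrite rmorphB !rmorphM rmorphD rmorph1/= oppr0.
Qed.

(** The weight is invariant under t -> 2 pi - t, which is complex conjugation on the circle; the
    substitution shows that the integral equals its opposite. *)
Lemma semicircle_int_odd (R : realType) (A : R) (h : R -> R) : continuous h ->
  (forall t, h (2 * pi - t) = - h t) -> semicircle_int A h = 0.
Proof.
move=> ch hN; have pi0 := pi_gt0 R.
pose k t := h t * semicircle A t.
have ck : continuous k.
  by move=> t; apply: cvgM; [exact: ch|exact: continuous_semicircle].
have kN t : k (2 * pi - t) = - k t.
  rewrite /k hN mulNr /semicircle; congr (- (_ * (_ * Num.sqrt (_ - _)))).
    by rewrite mulrBl (mulrC 2) mulfK ?pnatr_eq0// sinB sinpi cospi; ring.
  by rewrite mulrBl (mulrC 2) mulfK ?pnatr_eq0// cosB sinpi cospi; ring.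
pose F (t : R) := 2 * pi - t.
have dF (t : R) : is_derive t 1 F (-1).
  have d := @is_deriveB R R R (cst (2 * pi)) id t 1 _ _ (is_derive_cst _ _ _)
    (is_derive_id _ _).
  by apply: trigger_derive d _; rewrite sub0r.
have F' : F^`()%classic = cst (-1).
  by apply/funext => t; rewrite derive1E; have [_ ->] := dF t.
have cF : continuous F by move=> t; apply: cvgB; [exact: cvg_cst|exact: cvg_id].
have F0 : F 0 = 2 * pi by rewrite /F subr0.
have F2 : F (2 * pi) = 0 by rewrite /F subrr.
have sub : semicircle_int A h =
    \int[lebesgue_measure]_(t in `[0, 2 * pi]) (-1 * k t).
  have := @integration_by_substitution_decreasing R F k 0 (2 * pi).
  rewrite F0 F2 F' => H; congr fine; rewrite H.
  - by apply: eq_integral => t _; rewrite /= !fctE opprK mulr1 kN mulN1r.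
  - by rewrite mulr_ge0 ?pi_ge0.
  - by move=> s t _ _ st; rewrite /F ltrD2l ltrN2.
  - by move=> t _; exact: cvg_cst.
  - exact: is_cvg_cst.
  - exact: is_cvg_cst.
  - split; [by move=> t _; have [] := dF t|exact/cvg_at_right_filter/cF
           |exact/cvg_at_left_filter/cF].
  - exact: continuous_subspaceT.
have ik : lebesgue_measure.-integrable `[0, 2 * pi] (EFin \o k).
  exact: semicircle_integrable.
rewrite RintegralZl// mulN1r in sub.
have {}sub : semicircle_int A h = - semicircle_int A h by [].
by lra.
Qed.

Section gross_witten_orthogonal.
Context {R : realType} (g : R).
Hypothesis g1 : 1 < g.
Let A := g^-1.
Let mu : {measure set (R * R) -> \bar R} := gross_witten g.

Let A01 : 0 < A < 1.
Proof. by have g0 := lt_trans ltr01 g1; rewrite invr_gt0 g0 invf_lt1. Qed.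

Let mu_fin : (mu setT < +oo)%E := gross_witten_lty g1.
Let mu_circle : mu (~` @unit_circle R) = 0%E := gross_witten_circle g.

(** The disjunction says m = |n - 2 j| without truncated subtraction. The integrand is the Chebyshev
    factor times e^(i (2 j - n) t / 2): its real part carries cos (m t / 2), its imaginary part is
    odd under conjugation. *)
Lemma inner_para n j m : n = (j.*2 + m)%N \/ j.*2 = (n + m)%N ->
  inner mu (para A%:C n) 'X^j =
  (g / pi * semicircle_int A (fun t =>
     (cheb A n).[xvar t] * cos (m%:R * (t / 2))))%:C.
Proof.
move=> njm.
have [mRe mIm _] := circle_fun_inner (para A%:C n) 'X^j.
pose s (k : nat) (t : R) : R := k%:R * (t / 2).
have fE t : ((para A%:C n).[toC (expi t)])^*%C * ('X^j).[toC (expi t)] =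
  ((cheb A n).[xvar t])%:C * toC (expi (s j.*2 t - s n t)).
  have zj : (toC (expi t)) ^+ j = toC (expi (s j.*2 t)).
    rewrite /s -muln2; elim: (j) => [|i ih].
      by rewrite mul0n mul0r /expi /toC/= cos0 sin0.
    rewrite exprS ih -toC_expiD; congr (toC (expi _)).
    by rewrite mulSn natrD; field.
  rewrite para_expi hornerXn zj rmorphM/= oppr0 -mulrA; congr (_ * _).
  rewrite /toC /expi/= cosB sinB; apply/eqP; rewrite eq_complex/=.
  by apply/andP; split; apply/eqP; rewrite /s; ring.
rewrite /inner /cintegral !Rintegral_gross_witten//.
congr Complex.
- rewrite -semicircle_intZ; last exact: continuous_cheb_cos.
  congr semicircle_int; apply/funext => t; rewrite fE/= mul0r subr0.
  congr (_ * (_ * _)); rewrite /s; case: njm => ->.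
    by rewrite natrD mulrDl opprD addNKr cosN.
  by rewrite natrD mulrDl addrC addKr.
- apply: semicircle_int_odd => t.
    under eq_fun do rewrite fE/= mul0r addr0.
    apply: cvgMr; apply: cvgM; first exact: continuous_horner_xvar.
    apply: (@continuous_comp _ _ _ (fun t => s j.*2 t - s n t) sin).
      by apply: cvgB; apply: cvgMr; apply: cvgMl; exact: cvg_id.
    exact: continuous_sin.
  have -> : toC (expi (2 * pi - t)) = (toC (expi t))^*%C.
    rewrite /toC /expi/= cosB sinB (mulrC 2) mulr_natr sin2pi cos2pi.
    by rewrite !mul0r !mul1r addr0 sub0r.
  have ImJ (z : R[i]) : complex.Im (z^*%C) = - complex.Im z by case: z.
  by rewrite horner_conj_para !hornerXn -rmorphXn -rmorphM ImJ mulrN.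
Qed.

(** The condition 0 < j < n means exactly |n - 2 j| < n; the constant monomial is left out because
    it gives the diagonal integral. *)
Lemma inner_para0 n j : (0 < j < n)%N -> inner mu (para A%:C n) 'X^j = 0.
Proof.
move=> /andP[j0 jn]; have [h|h] := leqP j.*2 n.
  rewrite (@inner_para _ _ (n - j.*2)); last by left; lia.
  by rewrite semicircle_int_cheb_cos ?mulr0//; lia.
rewrite (@inner_para _ _ (j.*2 - n)); last by right; lia.
by rewrite semicircle_int_cheb_cos ?mulr0//; lia.
Qed.

Lemma inner_para_diag n :
  inner mu (para A%:C n.+1) 1 = (A ^+ n.+1 / 2)%:C * inner mu 1 1.
Proof.
have := @inner_para 0 0 0 (or_introl erefl).
have := @inner_para n.+1 0 n.+1 (or_introl erefl).
rewrite expr0 [para _ 0]/= => -> ->.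
rewrite semicircle_int_cheb_cos_diag// -rmorphM/=; congr _%:C.
rewrite mulrCA; congr (_ * (_ * _)); congr semicircle_int; apply/funext => t.
by rewrite mul0r cos0 hornerC mulr1.
Qed.

Lemma riccatiC n : riccati A%:C n = (riccati A n)%:C.
Proof.
elim: n => [|n ih]; first by rewrite /= rmorphD.
by rewrite !riccatiS ih rmorphB fmorph_div/= rmorphD.
Qed.

Let riccatiC_neq0 n : riccati A%:C n != 0.
Proof.
have [A0 A1] := andP A01; pose a := Num.sqrt (1 - A).
have a0 : 0 < a by rewrite sqrtr_gt0 subr_gt0.
have a1 : a < 1 by rewrite -[ltRHS]sqrtr1 ltr_sqrt// gtrBl.
have aA : 1 - a ^+ 2 = A by rewrite sqr_sqrtr ?subr_ge0 ?ltW// subKr.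
have := riccati_bound n a0 a1; rewrite aA => /andP[e1 _].
by rewrite riccatiC eq_complex/= eqxx andbT gt_eqF//; lra.
Qed.

(** For j = 0 the [para] terms cancel by the diagonal formula. For j + 1, [opuc_mulXsub1] makes (X -
    1) times the polynomial orthogonal to X^(j+1), so its product with X^(j+1) equals that of its
    shift, which the isometry brings back to X^j. *)
Lemma opuc_orthogonal n j : (j < n)%N -> inner mu (opuc A%:C n) 'X^j = 0.
Proof.
elim: j n => [|j ih] n.
  rewrite expr0; elim: n => // n ihn _.
  rewrite opucS (innerDl mu_fin)// (innerBl mu_fin)// !(innerZl mu_fin)//.
  rewrite riccatiC -fmorph_div !conjc_real inner_para_diag.
  (* At n = 0 the factor 1/2 is missing from the product of [para] with 1, and the [opuc] term
     compensates: A / 2 - A + A / 2 = 0, since [riccati] starts at 2. *)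
  case: n ihn => [_|n ihn].
    rewrite -[para _ 0]/1 -[opuc _ 0]/1 -[riccati _ 0]/2 -mulrBl -mulrDl.
    by rewrite -rmorphB -rmorphD/= (_ : _ + _ = 0) ?mul0r//; field.
  by rewrite inner_para_diag ihn// mulr0 addr0 mulrA -rmorphM/= mulrA -exprS subrr.
move=> jn.
have h1 : inner mu (para A%:C n.+1) 'X^(j.+1) = 0 by apply: inner_para0; lia.
have h2 : inner mu (para A%:C n) 'X^(j.+1) = 0 by apply: inner_para0; lia.
have : inner mu (('X - 1) * opuc A%:C n) 'X^(j.+1) = 0.
  rewrite opuc_mulXsub1; last exact: riccatiC_neq0.
  by rewrite (innerBl mu_fin)// (innerZl mu_fin)// h1 h2 mulr0 subr0.
rewrite mulrBl mul1r (innerBl mu_fin)// => /eqP; rewrite subr_eq0 => /eqP <-.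
by rewrite mulrC exprSr innerMX// ih// ltnW.
Qed.

Lemma gross_witten_verblunsky alpha k : verblunsky (gross_witten g) alpha ->
  alpha k = (1 - riccati g^-1 k.+1)%:C.
Proof.
move=> [Phi oPhi ->].
have [mo so] := opuc_monic A%:C k.+1.
rewrite (monic_orthogonal_unique mu_fin mu_circle (gross_witten_support g1) oPhi mo so).
  rewrite opuc_horner0; last exact: riccatiC_neq0.
  rewrite riccatiC -/A; move: (riccati A _) => r; apply/eqP; rewrite eq_complex/=.
  by apply/andP; split; apply/eqP; ring.
by move=> j; exact: opuc_orthogonal.
Qed.

End gross_witten_orthogonal.

(** * Summable Gross-Witten excesses and the equivalence *)

(** Here |alpha_k| = a + d_(k+1), where the distances d_k to the fixed point are nonnegative,
    decreasing and summable. Since d_(k+1) <= 1, both squares required by [excess_bounded] are at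
    most d_(k+1). *)
Lemma gross_witten_excess_bounded (R : realType) (g : R)
    (alpha : nat -> R[i]) : 1 < g -> verblunsky (gross_witten g) alpha ->
  (forall k, normc (alpha k) < 1) /\
  exists M, forall n, \sum_(0 <= k < n) excess g alpha k <= M.
Proof.
move=> g1 valpha; have g0 : 0 < g by exact: lt_trans g1.
have A1 : g^-1 < 1 by rewrite invf_lt1.
(* The positive root is taken, as the bounds on [riccati] require; [excess_bounded] sees a only
   through its square and absolute value. *)
have [a [a0 a1 a2]] : exists a : R, [/\ 0 < a, a < 1 & a ^+ 2 = 1 - g^-1].
  exists (Num.sqrt (1 - g^-1)); split.
  - by rewrite sqrtr_gt0 subr_gt0.
  - by rewrite -[ltRHS]sqrtr1 ltr_sqrt// gtrBl invr_gt0.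
  - by rewrite sqr_sqrtr// subr_ge0 ltW.
have alphaE k : alpha k = (1 - riccati (1 - a ^+ 2) k.+1)%:C.
  by rewrite (gross_witten_verblunsky _ _ valpha)// a2 subKr.
pose d k := riccati (1 - a ^+ 2) k - (1 + a).
have d0 k : 0 <= d k.
  by have /andP[? _] := riccati_bound k a0 a1; rewrite subr_ge0.
have d1 k : d k.+1 <= 1.
  by have := riccati_lt2 k a0 a1; rewrite /d; move: (riccati _ _) => e; lra.
have dS k : d k.+1 <= d k.
  apply: (le_trans (riccati_contract k a0 a1)); rewrite -/(d k) ler_piMl//.
  by rewrite ler_pdivrMr; lra.
have normE k : normc (alpha k) = a + d k.+1.
  have := d0 k.+1; rewrite alphaE /d; move: (riccati _ _) => e e0 /=.
  by rewrite expr0n/= addr0 sqrtr_sqr ler0_norm; lra.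
have alpha1 k : normc (alpha k) < 1.
  rewrite normE; have := riccati_lt2 k a0 a1; rewrite /d.
  by move: (riccati _ _) => e; lra.
have dsum : exists M, forall n, \sum_(0 <= k < n) d k.+1 <= M.
  exists (1 / a) => n; apply: le_trans (riccati_sum n.+1 a0 a1).
  by rewrite [leRHS]big_nat_recl// lerDr; exact: d0.
split=> //; apply/(excess_bounded g1 a2 alpha1); split.
- apply: (@bounded_sums_lin _ (fun k => d k.+1) (fun k => d k.+1) _ 1 0) => // k.
  rewrite mul1r mul0r addr0 !alphaE normc_sqrE/= subrr expr0n addr0.
  have -> : 1 - riccati (1 - a ^+ 2) k.+2 - (1 - riccati (1 - a ^+ 2) k.+1)
    = d k.+1 - d k.+2 by rewrite /d; ring.
  by have := d0 k.+2; have := dS k.+1; have := d1 k; nra.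
- apply: (@bounded_sums_lin _ (fun k => d k.+1) (fun k => d k.+1) _ 1 0) => // k.
  rewrite mul1r mul0r addr0 normE ger0_norm ?(ltW a0)// addrC addKr.
  by have := d1 k; have := d0 k.+1; nra.
Qed.

Theorem proposition6p2 (R : realType) (g : R) (hg : 1 < g)
    (mu : probability (R * R)%type R)
    (mu_circle : mu (unit_circle (R := R)) = 1%E)
    (mu_infinite : infinite_set (msupport mu))
    (alpha alphag : nat -> R[i])
    (h_alpha : verblunsky mu alpha)
    (h_alphag : verblunsky (gross_witten g) alphag)
    (a : R) (ha : a = - Num.sqrt (1 - g^-1)) :
  (ereal_sup [set (\sum_(0 <= k < L.+1) sum_rule_term g alpha alphag k)%:E
                 | L in [set L : nat | (1 <= L)%N]] < +oo)%E
  <->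
  (\sum_(0 <= k <oo) (normc (alpha k.+1 - alpha k) ^+ 2)%:E < +oo)%E /\
  (\sum_(0 <= k <oo) ((normc (alpha k) - `|a|) ^+ 2)%:E < +oo)%E.
Proof.
have g0 : 0 < g by exact: lt_trans hg.
have a2 : a ^+ 2 = 1 - g^-1.
  by rewrite ha sqrrN sqr_sqrtr// subr_ge0 ltW// invf_lt1.
have mu_fin : (mu setT < +oo)%E by rewrite probability_setT ltry.
have muC : mu (~` @unit_circle R) = 0%E.
  by rewrite probability_setC ?mu_circle ?subee//; exact: measurable_unit_circle.
have alpha1 k : normc (alpha k) < 1 by exact: (verblunsky_lt1 mu_fin muC).
have [alphag1 [Mg alphagM]] := gross_witten_excess_bounded hg h_alphag.
rewrite !nneseries_lty; try by move=> k; exact: sqr_ge0.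
rewrite -(excess_bounded hg a2 alpha1).
(* The excesses of [alphag] sum to a value in [0, Mg], and the boundary term has absolute value at
   most g / 2. *)
have term_bound n (x := \sum_(0 <= k < n.+1) sum_rule_term g alpha alphag k)
    (y := \sum_(0 <= k < n.+1) excess g alpha k) :
    y <= x + Mg + g / 2 /\ x <= y + g / 2.
  rewrite /x sum_rule_sum// -/y.
  have := alphagM n.+1; have : 0 <= \sum_(0 <= k < n.+1) excess g alphag k.
    by apply: sumr_ge0 => k _; exact: excess_ge0.
  have sq1 (z : R[i]) : normc z < 1 -> 0 <= normc z ^+ 2 <= 1.
    move=> z1; rewrite sqr_ge0/= -[leRHS](expr1n _ 2).
    by rewrite ler_sqr ?nnegrE ?normc_ge0// ltW.
  have /andP[] := sq1 _ (alpha1 n); have /andP[] := sq1 _ (alphag1 n).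
  by move: (_ ^+ 2) (_ ^+ 2) => u v *; split; nra.
split=> [supoo|[M exM]].
- have [M Mge] : exists M : R, forall L, (1 <= L)%N ->
      \sum_(0 <= k < L.+1) sum_rule_term g alpha alphag k <= M.
    set S := (X in ereal_sup X) in supoo.
    exists (fine (ereal_sup S)) => L L1.
    have SL : ((\sum_(0 <= k < L.+1) sum_rule_term g alpha alphag k)%:E
        <= ereal_sup S)%E by apply: ereal_sup_ubound; exists L.
    (* The supremum is not -oo because it dominates a real partial sum. *)
    rewrite -lee_fin fineK// fin_numE -ltey supoo andbT -ltNye.
    exact: lt_le_trans (ltNyr _) SL.
  exists (M + Mg + g / 2) => n.
  (* The supremum ranges over L >= 1, so only sums of at least two terms are controlled; shorter
     ones are bounded by adding nonnegative excesses. *)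
  apply: (@le_trans _ _ (\sum_(0 <= k < n.+2) excess g alpha k)).
    rewrite 2?big_nat_recr//= -addrA lerDl.
    by rewrite addr_ge0// excess_ge0.
  by have [+ _] := term_bound n.+1; move/le_trans; apply; have := Mge n.+1 isT; lra.
- apply: (@le_lt_trans _ _ (M + g / 2)%:E); last exact: ltry.
  apply: ge_ereal_sup => _ [L _ <-]; rewrite lee_fin.
  by have [_ /le_trans] := term_bound L; apply; rewrite lerD2r.
Qed.
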